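(* Let $n_0,\dots,n_r$ be positive integers with $n_0+\dots+n_r=n$, and let $p_0,\dots,p_r>0$. Let $\mathcal{X}\subset\prod_{i=0}^r\mathrm{Gr}(n_i,n)$ be the open set $\{\det(\mathsf{Z})\ne0\}$, and let $\Omega_{\mathrm{M}}$ be the symplectic form on $\prod_{i=0}^r\mathrm{Gr}(n_i,n)$ given by $$\Omega_{\mathrm{M}}=i\,\mathrm{Tr}\bigl(\mathrm{d}\mathsf{Z}^\dagger\wedge\mathrm{d}\mathsf{Z}\bigr),\qquad \mathsf{Z}=\begin{pmatrix}\mathsf{Z}_0&\mathsf{Z}_1&\cdots&\mathsf{Z}_r\end{pmatrix},\qquad \mathsf{Z}_i^\dagger\mathsf{Z}_i=p_i\,\mathds{1}_{n_i}.$$ Then $\mathcal{X}\subset\bigl(\prod_{i=0}^r\mathrm{Gr}(n_i,n),\Omega_{\mathrm{M}}\bigr)$ is symplectomorphic to an open subset of $\bigl(\mathrm{T}^\ast\mathcal{F}_{n_0,\dots,n_r},\Omega^0_{\mathrm{M}}\bigr)$, where $\mathcal{F}_{n_0,\dots,n_r}=\mathrm{SU}(n)/\mathrm{S}(\mathrm{U}(n_0)\times\cdots\times\mathrm{U}(n_r))$ and $$\Omega^0_{\mathrm{M}}=i\,\mathrm{Tr}\bigl(\mathsf{P}\,\mathrm{d}\mathsf{U}^\dagger\wedge\mathrm{d}\mathsf{U}\bigr)+i\,\mathrm{d}\Bigl(\sum_{j\ne k}\mathsf{K}_{jk}\,\bar u_j\,\mathrm{d}u_k\Bigr),\qquad \mathsf{P}=\mathrm{Diag}\bigl(p_0\mathds{1}_{n_0},\dots,p_r\mathds{1}_{n_r}\bigr),$$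 is the twisted symplectic form describing magnetic geodesic flow.
   Context: A point of $\mathrm{Gr}(n_i,n)$ (the Grassmannian of $n_i$-dimensional subspaces of $\mathbb{C}^n$) is represented by an $n\times n_i$ complex matrix $\mathsf{Z}_i$ with $\mathsf{Z}_i^\dagger\mathsf{Z}_i=p_i\mathds{1}_{n_i}$, whose columns span the subspace, modulo $\mathsf{Z}_i\mapsto\mathsf{Z}_ih_i$, $h_i\in\mathrm{U}(n_i)$. The $n\times n$ matrix $\mathsf{Z}$ is obtained by concatenating the $\mathsf{Z}_i$; the condition $\det\mathsf{Z}\neq0$ and the form $i\,\mathrm{Tr}(\mathrm{d}\mathsf{Z}^\dagger\wedge\mathrm{d}\mathsf{Z})$ descend to the quotient. The flag manifold $\mathcal{F}_{n_0,\dots,n_r}$ is parametrized by unitary matrices $\mathsf{U}\in\mathrm{U}(n)$ with columns $u_1,\dots,u_n$, modulo right multiplication by $\mathrm{U}(n_0)\times\cdots\times\mathrm{U}(n_r)$ (block-diagonal). Points of $\mathrm{T}^\ast\mathcal{F}_{n_0,\dots,n_r}$ are represented by pairs $(\mathsf{U},\mathsf{K})$, where $\mathsf{K}$ is a Hermitian $n\times n$ matrix whose diagonal blocks (of sizes $n_0,\dots,n_r$) are fixed to be $p_i\mathds{1}_{n_i}$ and whose off-diagonal blocks are the momenta (fiber coordinates), modulo $(\mathsf{U},\mathsf{K})\sim(\mathsf{U}h,h^\dagger\mathsf{K}h)$ for $h\in\mathrm{U}(n_0)\times\cdots\times\mathrm{U}(n_r)$. Here $\bar u_j\,\mathrm{d}u_k:=u_j^\dagger\,\mathrm{d}u_k$.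 The second term of $\Omega^0_{\mathrm{M}}$ is the standard symplectic form of the cotangent bundle, and the first is the pullback of a closed two-form from $\mathcal{F}_{n_0,\dots,n_r}$ (the magnetic field).
   Formalization: In Ω⁰_M the coefficient K_jk is taken to be the entry of K in row k and column j, so the sum is Tr(K_off U†dU); with the usual row-j, column-k indexing the form is not invariant under (U,K)~(Uh,h†Kh) and does not descend to T*F. *)

(* Defs.v *)
From HB Require Import structures.
From mathcomp Require Import all_boot all_order all_algebra.
From mathcomp Require Import spectral complex.
From mathcomp Require Import all_classical all_reals all_analysis.

Set Implicit Arguments.
Unset Strict Implicit.
Unset Printing Implicit Defensive.

Import Order.TTheory GRing.Theory Num.Theory.
Import numFieldNormedType.Exports.

Local Open Scope classical_set_scope.
Local Open Scope sesquilinear_scope.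
Local Open Scope ring_scope.

(* C^k and smooth maps on an open subset O of a finite-dimensional real normed
   space. *)
Fixpoint Ck (R : realType) (V W : normedModType R) (k : nat) (O : set V)
    (f : V -> W) : Prop :=
  if k is k'.+1 then
    (forall x, O x -> differentiable f x) /\ (forall v, Ck k' O ('D_v f))
  else forall x, O x -> {for x, continuous f}.

Definition smooth_on (R : realType) (V W : normedModType R) (O : set V)
    (f : V -> W) : Prop :=
  forall k, Ck k O f.

Definition derivC (R : realType) (V : normedModType R) (f : V -> R[i])
    (x v : V) : R[i] :=
  ('D_v (fun y => complex.Re (f y)) x +i* 'D_v (fun y => complex.Im (f y)) x)%C.

(* Exterior derivative of a complex-valued one-form alpha on V, where
   [alpha x v] is the value of alpha at x on the tangent vector v.  Conventions:
   (a /\ b)(v, w) = a(v) b(w) - a(w) b(v) and d(f dg) = df /\ dg. *)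
Definition extd (R : realType) (V : normedModType R) (alpha : V -> V -> R[i])
    (x v w : V) : R[i] :=
  derivC (fun y => alpha y w) x v - derivC (fun y => alpha y v) x w.

(* Wedge product of two matrix-valued covectors. *)
Definition wedgemx (R : realType) (V : Type) (m n p : nat)
    (a : V -> 'M[R[i]]_(m, n)) (b : V -> 'M[R[i]]_(n, p)) (v w : V) :
    'M[R[i]]_(m, p) :=
  a v *m b w - a w *m b v.

(* A quotient manifold M / G with a two-form: [qlevel] is an embedded
   submanifold M of a finite-dimensional real vector space, [qrel] is the orbit
   relation of a smooth free action of a compact group G on M, and [qform] is a
   two-form on the ambient space whose restriction to M is the pullback of the
   two-form of M / G.  The manifold structure on M / G is the one for which
   M -> M / G is a submersion. *)
Record quotient_manifold (R : realType) := QuotientManifold {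
  qamb : normedModType R;
  qlevel : set qamb;
  qrel : qamb -> qamb -> Prop;
  qform : qamb -> qamb -> qamb -> R[i] }.

Section QuotientManifold.
Context {R : realType}.
Implicit Types Q : quotient_manifold R.

(* The point of M / G represented by x, as an orbit. *)
Definition qclass Q (x : qamb Q) : set (qamb Q) :=
  [set y | qlevel y /\ qrel x y].

Definition qpoints Q : set (set (qamb Q)) := @qclass Q @` @qlevel R Q.

(* Quotient topology of the subspace topology. *)
Definition qopen Q (A : set (set (qamb Q))) : Prop :=
  A `<=` @qpoints Q /\
  exists2 O : set (qamb Q), open O &
    forall x, qlevel x -> (A (qclass x) <-> O x).

(* Tangent vectors of M: velocities of smooth curves in M. *)
Definition qtangent Q (x v : qamb Q) : Prop :=
  exists c : R -> qamb Q,
    [/\ smooth_on setT c, forall t, qlevel (c t), c 0 = x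
      & is_derive (0 : R) (1 : R) c v].

(* On the part of M lying in the ambient open set O and above A, the smooth
   map f between ambient spaces covers F : A -> M' / G'. *)
Definition local_lift Q Q' (A : set (set (qamb Q)))
    (F : set (qamb Q) -> set (qamb Q'))
    (O : set (qamb Q)) (f : qamb Q -> qamb Q') : Prop :=
  [/\ open O, smooth_on O f
    & forall x, O x -> qlevel x -> A (qclass x) ->
        qlevel (f x) /\ F (qclass x) = qclass (f x)].

(* Smoothness of F on the open set A.  As M' -> M' / G' has smooth local
   sections, F is smooth iff its composite with M -> M / G locally lifts to a
   smooth map into M'. *)
Definition qsmooth Q Q' (A : set (set (qamb Q)))
    (F : set (qamb Q) -> set (qamb Q')) : Prop :=
  forall x : qamb Q, qlevel x -> A (qclass x) ->
    exists O f, O x /\ @local_lift Q Q' A F O f.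

(* F^* omega' = omega on A, both sides being pulled back to M. *)
Definition qpullback_form Q Q' (A : set (set (qamb Q)))
    (F : set (qamb Q) -> set (qamb Q')) : Prop :=
  forall O f, @local_lift Q Q' A F O f ->
  forall x v w : qamb Q, O x -> qlevel x -> A (qclass x) ->
    qtangent x v -> qtangent x w ->
    qform (f x) ('D_v f x) ('D_w f x) = qform x v w.

(* The open sets A and B are symplectomorphic. *)
Definition symplectomorphic Q Q' (A : set (set (qamb Q)))
    (B : set (set (qamb Q'))) : Prop :=
  exists (F : set (qamb Q) -> set (qamb Q'))
         (G : set (qamb Q') -> set (qamb Q)),
  [/\ forall a, A a -> B (F a) /\ G (F a) = a,
      forall b, B b -> A (G b) /\ F (G b) = b,
      @qsmooth Q Q' A F, @qsmooth Q' Q B G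
    & @qpullback_form Q Q' A F].

End QuotientManifold.

(* Complex m x n matrices as a real normed space: real and imaginary parts. *)
Notation cmx R m n := ('M[R]_(m, n) * 'M[R]_(m, n))%type.

Definition toC (R : realType) (m n : nat) (z : cmx R m n) : 'M[R[i]]_(m, n) :=
  \matrix_(a, b) (z.1 a b +i* z.2 a b)%C.

Section Spaces.
Context {R : realType} (r : nat) (d : 'I_r.+1 -> nat) (p : 'I_r.+1 -> R).

Local Notation n := (\sum_i d i)%N.
Local Notation C := R[i].

(* The elements of U(n_0) x ... x U(n_r), embedded block-diagonally in U(n). *)
Definition block_unitary : set 'M[C]_n :=
  [set h | exists2 g : forall i, 'M[C]_(d i),
     forall i, g i \is unitarymx & h = \mxdiag_i g i].

(* [submxrow (toC z) i] is the block Z_i of Z = (Z_0 ... Z_r). *)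
Definition gr_level : set (cmx R n n) :=
  [set z | forall i, (submxrow (toC z) i)^t* *m submxrow (toC z) i
                     = ((p i)%:C)%C%:M].

Definition gr_rel (z z' : cmx R n n) : Prop :=
  exists2 h, block_unitary h & toC z' = toC z *m h.

(* Z being a linear coordinate, dZ evaluated on v is [toC v]. *)
Definition Omega_M (z v w : cmx R n n) : C :=
  'i%C * \tr (wedgemx (fun u => (toC u)^t*) (fun u => toC u) v w).

Definition GrProd : quotient_manifold R :=
  @QuotientManifold R (cmx R n n) gr_level gr_rel Omega_M.

Definition gr_det_neq0 : set (set (cmx R n n)) :=
  @qclass R GrProd @` (gr_level `&` [set z | \det (toC z) != 0]).

(* Pairs (U, K).  The flag manifold SU(n) / S(U(n_0) x ... x U(n_r)) is
   presented as U(n) / (U(n_0) x ... x U(n_r)). *)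
Definition flag_level : set (cmx R n n * cmx R n n) :=
  [set x | [/\ toC x.1 \is unitarymx, (toC x.2)^t* = toC x.2
             & forall i, submxblock (toC x.2) i i = ((p i)%:C)%C%:M]].

Definition flag_rel (x x' : cmx R n n * cmx R n n) : Prop :=
  exists2 h, block_unitary h &
    toC x'.1 = toC x.1 *m h /\ toC x'.2 = h^t* *m toC x.2 *m h.

Definition Pmx : 'M[C]_n := \mxdiag_(i < r.+1) (((p i)%:C)%C%:M : 'M[C]_(d i)).

(* The sum over j != k of K_jk u_j^dagger du_k.  For the form to be invariant
   under (U, K) ~ (U h, h^dagger K h), K_jk has to denote the entry of K in
   row k and column j, so that the sum is Tr(K_off U^dagger dU) with K_off the
   off-diagonal part of K; with the transposed indexing it does not descend to
   the quotient. *)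
Definition theta (x v : cmx R n n * cmx R n n) : C :=
  \sum_j \sum_(k | j != k)
    toC x.2 k j * ((col j (toC x.1))^t* *m col k (toC v.1)) 0 0.

Definition Omega0_M (x v w : cmx R n n * cmx R n n) : C :=
  'i%C * \tr (Pmx *m wedgemx (fun u : cmx R n n * cmx R n n => (toC u.1)^t*)
                             (fun u : cmx R n n * cmx R n n => toC u.1) v w)
  + 'i%C * extd theta x v w.

Definition TFlag : quotient_manifold R :=
  @QuotientManifold R (cmx R n n * cmx R n n)%type flag_level flag_rel Omega0_M.

End Spaces.

Arguments GrProd {R r} d p.
Arguments gr_det_neq0 {R r} d p.
Arguments TFlag {R r} d p.

(* Main.v *)
Require Import Defs.
From HB Require Import structures.
From mathcomp Require Import all_boot all_order all_algebra.
From mathcomp Require Import spectral complex.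
From mathcomp Require Import all_classical all_reals all_analysis.
From mathcomp Require Import ring.
(* Imported last so that derivC is the derivative of complex-valued functions
   and not the lemma on derivatives of constant polynomials. *)
Require Import Defs.

(** The symplectomorphism is the polar decomposition.  An invertible Z is
uniquely U S with U unitary and S positive definite, namely S is the square
root of the Gram matrix K = Z^H Z (^H is the adjoint), and the normalization of
the blocks of Z says exactly that the diagonal blocks of K are the scalars p_i.
So Z |-> (U, K) maps the level set of the Grassmannians to the level set of the cotangent
bundle, with inverse (U, K) |-> U sqrt(K) defined where K is positive definite,
which is an open condition.  Replacing Z by Z h with h block-unitary replaces K
by h^H K h, hence S by h^H S h by uniqueness of the square root, and U by U h:
both maps descend to the quotients ([to_flag_equiv], [to_gr_equiv]).

Smoothness reduces to that of the square root.  If S(y)^2 = K(y), then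
X = S(y) - S(x) solves the Sylvester equation S(x) X + X S(x) = E - X^2 with
E = K(y) - K(x).  The operator X |-> S X + X S is invertible for S positive
definite, and a coercivity estimate bounds X by a multiple of E
([sylvester_bound]), so that the term X^2 is negligible and S is differentiable
([sqrtmx_diff]).  The derivative D of S in a direction v solves S D + D S = D_v K;
it is therefore a rational expression in the entries of S and of D_v K, and an
induction on the order of differentiability follows ([sqrtmx_Ck]).

For the forms, put A = U^H dU, which is anti-Hermitian.  Expanding
dZ = dU S + U dS gives
  Tr (dZ^H /\ dZ) = Tr (K dU^H /\ dU) + Tr ((S dS + dS S) /\ A)
                  = Tr (K dU^H /\ dU) + Tr (dK /\ A),
because Tr (dS /\ dS) = 0 ([polar_trace]).  As the diagonal blocks of K are
constant, the right-hand side is the sum of Tr (P dU^H /\ dU) and of the exterior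
derivative of the tautological form ([Omega0_tangent]).

The pullback condition concerns every smooth lift f of the map between the
quotients and not only the polar one.  For such an f, the point of the first
level set obtained from f(Z) is Z h(Z) with h(Z) block-unitary.  The form
Tr (dZ^H /\ dZ) does not change under Z |-> Z h ([gauge_trace]): the extra terms
pair the block-diagonal anti-Hermitian matrix dh h^H either with d(Z^H Z), whose
diagonal blocks vanish, or with itself. *)

Set Implicit Arguments.
Unset Strict Implicit.
Unset Printing Implicit Defensive.

Import Order.TTheory GRing.Theory Num.Theory.
Import numFieldNormedType.Exports.

Local Open Scope classical_set_scope.
Local Open Scope sesquilinear_scope.
Local Open Scope ring_scope.

(** * Positive definite matrices and the Sylvester equation *)

Section PosDef.
Context {C : numClosedFieldType}.

Lemma adjM m n p (A : 'M[C]_(m, n)) (B : 'M[C]_(n, p)) :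
  (A *m B)^t* = B^t* *m A^t*.
Proof. by rewrite trmx_mul map_mxM. Qed.

Lemma adjD m n (A B : 'M[C]_(m, n)) : (A + B)^t* = A^t* + B^t*.
Proof. by rewrite linearD map_mxD. Qed.

Lemma adjB m n (A B : 'M[C]_(m, n)) : (A - B)^t* = A^t* - B^t*.
Proof. by rewrite linearB map_mxB. Qed.

Lemma adjZ m n (a : C) (A : 'M[C]_(m, n)) : (a *: A)^t* = a^* *: A^t*.
Proof. by apply/matrixP => i j; rewrite !mxE rmorphM. Qed.

Lemma adj_scalar n (a : C) : (a%:M : 'M[C]_n)^t* = a^*%:M.
Proof. by rewrite tr_scalar_mx map_scalar_mx. Qed.

Lemma adj1 n : (1%:M : 'M[C]_n)^t* = 1%:M.
Proof. by rewrite adj_scalar conjC1. Qed.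

Lemma adj0 m n : (0 : 'M[C]_(m, n))^t* = 0.
Proof. by rewrite linear0 map_mx0. Qed.

Lemma mxtrace_adj n (A : 'M[C]_n) : \tr (A^t*) = (\tr A)^*.
Proof. by rewrite rmorph_sum; apply: eq_bigr => i _; rewrite !mxE. Qed.

Lemma unitarymxPl n (U : 'M[C]_n) : U \is unitarymx -> U^t* *m U = 1%:M.
Proof. by move=> uU; rewrite -invmx_unitary // mulVmx // unitarymx_unit. Qed.

Lemma unitarymxPr n (U : 'M[C]_n) : U \is unitarymx -> U *m U^t* = 1%:M.
Proof. by move/unitarymxP. Qed.

(** The squared Hilbert-Schmidt norm. *)
Definition sqnorm m n (X : 'M[C]_(m, n)) : C := \tr (X *m X^t*).

Lemma sqnormE m n (X : 'M[C]_(m, n)) : sqnorm X = \sum_i \sum_j `|X i j| ^+ 2.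
Proof.
apply: eq_bigr => i _; rewrite mxE; apply: eq_bigr => j _.
by rewrite !mxE normCK.
Qed.

Lemma sqnorm_ge0 m n (X : 'M[C]_(m, n)) : 0 <= sqnorm X.
Proof. by rewrite sqnormE; do 2?apply: sumr_ge0 => ? _; rewrite exprn_ge0. Qed.

Lemma sqnorm_eq0 m n (X : 'M[C]_(m, n)) : sqnorm X = 0 -> X = 0.
Proof.
rewrite sqnormE => /eqP; rewrite psumr_eq0; last first.
  by move=> i _; apply: sumr_ge0 => j _; rewrite exprn_ge0.
move=> /allP X0; apply/matrixP => i j; rewrite mxE.
have := X0 i (mem_index_enum _); rewrite psumr_eq0; last first.
  by move=> k _; rewrite exprn_ge0.
move=> /allP /(_ j (mem_index_enum _)); rewrite /= sqrf_eq0 normr_eq0.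
by move/eqP.
Qed.

Lemma sqnorm_entry m n (X : 'M[C]_(m, n)) i j : `|X i j| ^+ 2 <= sqnorm X.
Proof.
rewrite sqnormE (bigD1 i) //= (bigD1 j) //= -addrA lerDl addr_ge0 //.
  by apply: sumr_ge0 => k _; rewrite exprn_ge0.
by do 2?apply: sumr_ge0 => ? _; rewrite exprn_ge0.
Qed.

Lemma sqnorm_entry2 m n (X : 'M[C]_(m, n)) i j k l :
  `|X i j| * `|X k l| <= sqnorm X.
Proof.
have [le|le] := real_leP (normr_real (X i j)) (normr_real (X k l)).
  apply: le_trans (sqnorm_entry X k l).
  by rewrite expr2 ler_wpM2r.
apply: le_trans (sqnorm_entry X i j).
by rewrite expr2 ler_wpM2l // ltW.
Qed.

Definition posdef n (K : 'M[C]_n) : Prop :=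
  K^t* = K /\ forall u : 'rV[C]_n, u != 0 -> 0 < (u *m K *m u^t*) 0 0.

(** In the coordinates u P^H the quadratic form is a sum of squares with
positive weights. *)
Lemma posdef_diag n (P : 'M[C]_n) (l : 'rV[C]_n) : P \is unitarymx ->
  (forall j, 0 < l 0 j) -> posdef (P^t* *m diag_mx l *m P).
Proof.
move=> uP l0; split.
  rewrite !adjM trmxCK mulmxA; congr (_ *m _ *m _).
  rewrite tr_diag_mx map_diag_mx; congr diag_mx.
  by apply/rowP => j; rewrite mxE; apply/CrealP/ger0_real/ltW.
move=> u u0; set y := u *m P^t*.
have -> : u *m (P^t* *m diag_mx l *m P) *m u^t* = y *m diag_mx l *m y^t*.
  by rewrite /y adjM trmxCK !mulmxA.
have y0 : y != 0.
  apply: contraNneq u0 => y0.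
  by rewrite -[u]mulmx1 -(unitarymxPl uP) mulmxA -/y y0 mul0mx.
rewrite mul_mx_diag mxE.
have [j yj] : exists j, y 0 j != 0.
  apply/existsP; apply: contraNT y0; rewrite negb_exists => /forallP y0.
  by apply/eqP/rowP => j; rewrite [RHS]mxE; have := y0 j; rewrite negbK => /eqP.
have E k : (\matrix_(i, j) (y i j * l 0 j)) 0 k * y^t* k 0 = l 0 k * `|y 0 k| ^+ 2.
  by rewrite !mxE normCK mulrA (mulrC (l 0 k)).
rewrite (bigD1 j) //= E ltr_pwDl //.
  by rewrite mulr_gt0 // exprn_gt0 // normr_gt0.
by apply: sumr_ge0 => k _; rewrite E mulr_ge0 // ?exprn_ge0 // ltW.
Qed.

(** The spectral theorem; the eigenvalue l_j is the value of the quadratic form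
at the j-th row of P. *)
Lemma posdef_spectral n (K : 'M[C]_n) : posdef K ->
  exists (P : 'M[C]_n) (l : 'rV[C]_n), [/\ P \is unitarymx, forall j, 0 < l 0 j
    & K = P^t* *m diag_mx l *m P].
Proof.
move=> [hK pK]; have nK : K \is normalmx by apply/normalmxP; rewrite hK.
have uP := spectral_unitarymx K.
have := orthomx_spectralP nK; rewrite invmx_unitary //.
set P := spectralmx K in uP *; set l := spectral_diag K => KE.
exists P, l; split => // j.
have -> : l 0 j = (row j P *m K *m (row j P)^t*) 0 0.
  rewrite KE rowE !mulmxA -(mulmxA _ P (P^t*)) unitarymxPr // mulmx1 adjM !mulmxA.
  rewrite -(mulmxA _ P (P^t*)) unitarymxPr // mulmx1 -rowE mxE (bigD1 j) //= big1 => [|k kj].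
    by rewrite !mxE !eqxx mulr1n rmorph1 mulr1 addr0.
  by rewrite !mxE (negPf kj) rmorph0 mulr0.
apply: pK; apply/eqP => P0; have := unitarymxPr uP => /matrixP /(_ j j).
rewrite [RHS]mxE eqxx => /eqP; rewrite mxE big1 ?[0 == _]eq_sym ?oner_eq0 // => k _.
by have /rowP /(_ k) := P0; rewrite !mxE => ->; rewrite mul0r.
Qed.

(** A lower bound for the spectrum.  It is the inverse of 1 + sum_j 1 / l_j,
which is below every eigenvalue l_j and makes sense in dimension zero. *)
Lemma posdef_bound n (K : 'M[C]_n) : posdef K ->
  exists2 c : C, 0 < c & forall m (X : 'M[C]_(m, n)),
    c * sqnorm X <= \tr (X *m K *m X^t*).
Proof.
move=> /posdef_spectral [P [l [uP l0 ->]]].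
pose b := 1 + \sum_j (l 0 j)^-1.
have b0 : 0 < b.
  by rewrite ltr_pwDl // sumr_ge0 // => j _; rewrite invr_ge0 ltW.
have bl j : b^-1 <= l 0 j.
  rewrite -[leRHS]invrK lef_pV2 ?qualifE /= ?invr_gt0 //.
  rewrite /b (bigD1 j) //= addrCA lerDl addr_ge0 // sumr_ge0 // => k _.
  by rewrite invr_ge0 ltW.
exists b^-1; first by rewrite invr_gt0.
move=> m X; set Y := X *m P^t*.
have -> : sqnorm X = sqnorm Y.
  by rewrite /sqnorm /Y adjM trmxCK mulmxA -(mulmxA X) unitarymxPl // mulmx1.
have -> : X *m (P^t* *m diag_mx l *m P) *m X^t* = Y *m diag_mx l *m Y^t*.
  by rewrite /Y adjM trmxCK !mulmxA.
clearbody Y; rewrite sqnormE mulr_sumr; apply: ler_sum => i _.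
rewrite mul_mx_diag !mxE mulr_sumr; apply: ler_sum => j _.
by rewrite !mxE -mulrA (mulrCA (Y i j)) -normCK ler_wpM2r // exprn_ge0.
Qed.

Lemma posdef_trace_ge0 n (K : 'M[C]_n) m (X : 'M[C]_(m, n)) : posdef K ->
  0 <= \tr (X *m K *m X^t*).
Proof.
move=> /posdef_bound [c c0 H]; apply: le_trans (H _ _).
by rewrite mulr_ge0 ?sqnorm_ge0 // ltW.
Qed.

Lemma posdef_unit n (K : 'M[C]_n) : posdef K -> K \in unitmx.
Proof.
move=> [_ pK]; rewrite -row_free_unit; apply: inj_row_free => v vK.
by apply/eqP; apply: contraT => /pK; rewrite vK mul0mx mxE ltxx.
Qed.

Lemma posdef1 n : posdef (1%:M : 'M[C]_n).
Proof.
split=> [|u u0]; first by rewrite adj1.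
rewrite mulmx1 lt_neqAle; apply/andP; split.
  apply: contraNneq u0 => u0; apply/eqP/sqnorm_eq0.
  by rewrite /sqnorm /mxtrace big_ord1.
by have := sqnorm_ge0 u; rewrite /sqnorm /mxtrace big_ord1.
Qed.

Lemma posdef_congr n (K A : 'M[C]_n) : A \in unitmx -> posdef K ->
  posdef (A^t* *m K *m A).
Proof.
move=> uA [hK pK]; split=> [|u u0]; first by rewrite !adjM trmxCK hK mulmxA.
have -> : u *m (A^t* *m K *m A) *m u^t* = (u *m A^t*) *m K *m (u *m A^t*)^t*.
  by rewrite adjM trmxCK !mulmxA.
apply: pK; apply: contraNneq u0 => uA0.
have uA' : A^t* \in unitmx by rewrite map_unitmx unitmx_tr.
by rewrite -[u](mulmxK uA') uA0 mul0mx.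
Qed.

Lemma posdef_gram n (A : 'M[C]_n) : A \in unitmx -> posdef (A^t* *m A).
Proof. by move=> uA; rewrite -[A^t*]mulmx1; apply: posdef_congr (posdef1 n). Qed.

(** Pair the equation with X.  Then tr (X^H S X) >= 0 and tr (X T X^H) >=
c |X|^2 give c |X|^2 <= tr (E X^H), and |c X - E|^2 >= 0 absorbs the right-hand
side.  The constant depends on T only, which makes the bound uniform while S
varies. *)
Lemma sylvester_bound n (T : 'M[C]_n) : posdef T ->
  exists2 c : C, 0 < c & forall S X E : 'M[C]_n, posdef S ->
    S *m X + X *m T = E -> c ^+ 2 * sqnorm X <= sqnorm E.
Proof.
move=> /posdef_bound [c c0 bT]; exists c => // S X E pS XE.
pose t := \tr (E *m X^t*).
have ct : c * sqnorm X <= t.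
  rewrite /t -XE mulmxDl mxtraceD -[leLHS]add0r lerD ?bT //.
  rewrite mxtrace_mulC mulmxA -[X in _ *m X]trmxCK.
  exact: posdef_trace_ge0.
have cR : c^* = c by apply/CrealP/ger0_real/ltW.
have tR : t^* = t.
  by apply/CrealP/ger0_real; apply: le_trans ct; rewrite mulr_ge0 ?sqnorm_ge0 // ltW.
have := sqnorm_ge0 (c *: X - E).
have -> : sqnorm (c *: X - E) = c ^+ 2 * sqnorm X - c * t - c * t + sqnorm E.
  rewrite {1}/sqnorm adjB adjZ cR mulmxBl !mulmxBr !raddfB /=.
  rewrite -!scalemxAl -!scalemxAr !mxtraceZ -/(sqnorm _) -/(sqnorm _) -/t.
  have -> : \tr (X *m E^t*) = t.
    by rewrite -tR /t -mxtrace_adj adjM trmxCK.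
  by rewrite mulrA -expr2; ring.
move=> sq; rewrite -subr_ge0.
have -> : sqnorm E - c ^+ 2 * sqnorm X =
  (c ^+ 2 * sqnorm X - c * t - c * t + sqnorm E) + (c + c) * (t - c * sqnorm X).
  by ring.
by rewrite addr_ge0 // mulr_ge0 ?subr_ge0 // addr_ge0 // ltW.
Qed.

Lemma sylvester_inj n (S T X : 'M[C]_n) : posdef S -> posdef T ->
  S *m X + X *m T = 0 -> X = 0.
Proof.
move=> pS pT SX; have [c c0 H] := sylvester_bound pT.
have := H _ _ _ pS SX; rewrite [leRHS]/sqnorm mul0mx mxtrace0 => le0.
apply: sqnorm_eq0; apply/eqP; rewrite eq_le sqnorm_ge0 andbT.
by rewrite -(pmulr_rle0 _ (exprn_gt0 2 c0)).
Qed.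

Lemma posdef_sqrt_exists n (K : 'M[C]_n) : posdef K ->
  exists2 S, posdef S & S *m S = K.
Proof.
move=> /posdef_spectral [P [l [uP l0 ->]]].
exists (P^t* *m diag_mx (map_mx sqrtC l) *m P).
  by apply: posdef_diag => // j; rewrite mxE sqrtC_gt0.
rewrite !mulmxA -(mulmxA _ P (P^t*)) unitarymxPr // mulmx1 -[in LHS](mulmxA (P^t*)).
rewrite mulmx_diag; congr (_ *m diag_mx _ *m _).
by apply/rowP => j; rewrite !mxE -expr2 sqrtCK.
Qed.

(** The difference X = S - T satisfies S X + X T = S^2 - T^2 = 0. *)
Lemma posdef_sqrt_unique n (S T : 'M[C]_n) : posdef S -> posdef T ->
  S *m S = T *m T -> S = T.
Proof.
move=> pS pT ST; apply/eqP; rewrite -subr_eq0; apply/eqP.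
apply: (sylvester_inj pS pT).
by rewrite mulmxBr mulmxBl addrA subrK ST subrr.
Qed.

(** The matrix of X |-> S X + X S acting on the row vectors [mxvec X]. *)
Definition sylvester n (S : 'M[C]_n) : 'M[C]_(n * n) := lin_mulmx S + lin_mulmxr S.

Lemma sylvesterE n (S X : 'M[C]_n) : mxvec X *m sylvester S = mxvec (S *m X + X *m S).
Proof. by rewrite mulmxDr !mul_vec_lin -linearD. Qed.

Lemma sylvester_unit n (S : 'M[C]_n) : posdef S -> sylvester S \in unitmx.
Proof.
move=> pS; rewrite -row_free_unit; apply: inj_row_free => v.
rewrite -[v]vec_mxK sylvesterE => /(canRL mxvecK); rewrite linear0 => SX.
by rewrite (sylvester_inj pS pS SX) linear0.
Qed.

Lemma sylvester_solve n (S X E : 'M[C]_n) : posdef S -> S *m X + X *m S = E ->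
  X = vec_mx (mxvec E *m invmx (sylvester S)).
Proof.
by move=> pS <-; rewrite -sylvesterE mulmxK ?mxvecK // sylvester_unit.
Qed.

(** The quadratic form of E is at most sum |E_ij| times |u|^2, since
|u_i| |u_j| <= |u|^2. *)
Lemma posdef_perturb n (K E : 'M[C]_n) c : (K + E)^t* = K + E ->
  (forall u : 'rV[C]_n, c * sqnorm u <= \tr (u *m K *m u^t*)) ->
  \sum_i \sum_j `|E i j| < c -> posdef (K + E).
Proof.
move=> hKE bK Ec; split=> // u u0.
have s0 : 0 < sqnorm u.
  by rewrite lt_neqAle sqnorm_ge0 andbT eq_sym; apply: contraNneq u0 => /sqnorm_eq0 ->.
set a := (u *m (K + E) *m u^t*) 0 0.
have aR : a \is Num.real.
  apply/CrealP; have -> : a^* = ((u *m (K + E) *m u^t*)^t*) 0 0.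
    by rewrite [RHS]mxE [in RHS]mxE.
  by rewrite !adjM trmxCK hKE mulmxA.
set b := \tr (u *m K *m u^t*) in bK.
set w := \tr (u *m E *m u^t*).
have aE : a = b + w.
  by rewrite /a mulmxDr mulmxDl mxE /b /w /mxtrace !big_ord1.
have cs : c \is Num.real.
  apply: (ger0_real (le_trans _ (ltW Ec))).
  by do 2?apply: sumr_ge0 => ? _.
have bR : b \is Num.real.
  rewrite -(subrK (c * sqnorm u) b) rpredD ?rpredM // ?ger0_real ?sqnorm_ge0 //.
  by rewrite subr_ge0.
have wR : w \is Num.real by rewrite -[w](addKr b) -aE rpredD // rpredN.
have wle : `|w| <= (\sum_i \sum_j `|E i j|) * sqnorm u.
  rewrite /w /mxtrace big_ord1 mxE (le_trans (ler_norm_sum _ _ _)) //.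
  rewrite exchange_big mulr_suml ler_sum // => j _ /=.
  rewrite !mxE normrM mulr_suml.
  apply: (@le_trans _ _ (\sum_i (`|u 0 i| * `|E i j|) * `|u 0 j|)).
    rewrite norm_conjC -mulr_suml ler_wpM2r // (le_trans (ler_norm_sum _ _ _)) //.
    by apply: ler_sum => i _; rewrite normrM.
  apply: ler_sum => i _; rewrite mulrAC mulrC ler_wpM2l //.
  exact: sqnorm_entry2.
rewrite aE -(opprK w) subr_gt0; apply: lt_le_trans (bK u).
apply: (@le_lt_trans _ _ `|w|).
  by rewrite -normrN real_ler_norm // rpredN.
by apply: le_lt_trans wle _; rewrite ltr_pM2r.
Qed.

End PosDef.

(** * Differentiable and C^k maps *)

Section RealCalculus.
Context {R : realType}.
Implicit Types V W : normedModType R.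

(** A function dominated by one that vanishes to first order is negligible.
This is how the quadratic remainder of the square root is discarded. *)
Lemma small_differentiable V W (f : V -> W) (q : V -> R) (x : V) :
  (\forall y \near x, `|f y| <= q y) ->
  differentiable q x -> q x = 0 -> (forall v, 'D_v q x = 0) ->
  differentiable f x.
Proof.
move=> fq dq q0 dq0.
have fx0 : f x = 0.
  by apply/eqP; rewrite -normr_le0 -q0; exact: nbhs_singleton fq.
have dq0' : 'd q x = 0 :> (V -> R).
  by rewrite funeqE => v; rewrite -deriveE.
have key : f \o shift x = cst (f x) + \0 +o_ 0 id.
  apply/eqaddoP => e e0.
  have := diff_locally dq; rewrite q0 dq0' => /eqaddoP /(_ e e0) qo.
  have fq' : \forall y \near 0, `|f (y + x)| <= q (y + x).
    by move: fq; rewrite (near_shift 0) /= subr0; apply.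
  apply: filterS2 fq' qo => h; rewrite /= !fctE /= fx0 !addr0 !subr0 => H1 H2.
  exact: le_trans H1 (le_trans (ler_norm _) H2).
have c0 : continuous (\0 : {linear V -> W}) by exact: cst_continuous.
apply/diff_locallyP; rewrite (diff_unique c0 key); split=> //.
Qed.

Lemma near_differentiable V W (f g : V -> W) (x : V) :
  (\forall y \near x, f y = g y) -> differentiable f x -> differentiable g x.
Proof.
move=> fg df; have -> : g = f + (g - f) by rewrite addrC subrK.
apply: differentiableD => //.
apply: (@small_differentiable _ _ _ (cst 0)) => //.
- by near=> y; rewrite !fctE; have -> : f y = g y; [near: y|rewrite subrr normr0].
- by move=> v; rewrite derive_cst.
Unshelve. all: by end_near. Qed.


Lemma Ck_eq V W k (O : set V) (f g : V -> W) : open O ->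
  (forall x, O x -> f x = g x) -> Ck k O f -> Ck k O g.
Proof.
move=> oO; elim: k f g => [|k IH] f g fg.
  move=> cf x Ox; have nfg : \forall y \near x, f y = g y.
    by apply: filterS fg _; exact: open_nbhs_nbhs.
  rewrite /prop_for /continuous_at -(fg _ Ox).
  apply: (@cvg_trans _ (f @ x)); last exact: cf.
  by apply: near_eq_cvg.
move=> [df Df]; split=> [x Ox|v].
  apply: near_differentiable (df x Ox).
  by apply: filterS fg _; exact: open_nbhs_nbhs.
apply: IH (Df v) => x Ox; apply: near_eq_derive.
by apply: filterS fg _; exact: open_nbhs_nbhs.
Qed.

Lemma CkW V W k (O : set V) (f : V -> W) : Ck k.+1 O f -> Ck k O f.
Proof.
elim: k f => [|k IH] f [df Df].
  by move=> x Ox; exact/differentiable_continuous/df.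
by split=> // v; apply: IH (Df v).
Qed.

Lemma Ck_cst V W k (O : set V) (a : W) : Ck k O (fun=> a).
Proof.
elim: k a => [|k IH] a; first by move=> x _; exact: cst_continuous.
split=> [x _|v]; first exact: differentiable_cst.
have -> : 'D_v (fun=> a) = (fun=> 0) :> (V -> W); last exact: IH.
by rewrite funeqE => x; rewrite derive_cst.
Qed.

Lemma CkD V W k (O : set V) (f g : V -> W) : open O ->
  Ck k O f -> Ck k O g -> Ck k O (fun x => f x + g x).
Proof.
move=> oO; elim: k f g => [|k IH] f g.
  by move=> cf cg x Ox; apply: continuousD; [exact: cf|exact: cg].
move=> [df Df] [dg Dg]; split=> [x Ox|v].
  by apply: differentiableD; [exact: df|exact: dg].
apply: Ck_eq (IH _ _ (Df v) (Dg v)) => // x Ox; apply/esym/deriveD.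
  exact/diff_derivable/df.
exact/diff_derivable/dg.
Qed.

Lemma CkM V k (O : set V) (f g : V -> R) : open O ->
  Ck k O f -> Ck k O g -> Ck k O (fun x => f x * g x).
Proof.
move=> oO; elim: k f g => [|k IH] f g.
  by move=> cf cg x Ox; apply: continuousM; [exact: cf|exact: cg].
move=> Cf Cg; have [[df Df] [dg Dg]] := (Cf, Cg); split=> [x Ox|v].
  by apply: differentiableM; [exact: df|exact: dg].
have := CkD oO (IH _ _ (CkW Cf) (Dg v)) (IH _ _ (CkW Cg) (Df v)).
apply: Ck_eq => // x Ox; apply/esym/deriveM.
  exact/diff_derivable/df.
exact/diff_derivable/dg.
Qed.

Lemma CkV V k (O : set V) (f : V -> R) : open O -> (forall x, O x -> f x != 0) ->
  Ck k O f -> Ck k O (fun x => (f x)^-1).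
Proof.
move=> oO f0; elim: k => [|k IH].
  by move=> cf x Ox; apply: continuousV; [exact: f0|exact: cf].
move=> Cf; have [df Df] := Cf; split=> [x Ox|v].
  by apply: differentiableV; [exact: df|exact: f0].
have Cv := IH (CkW Cf).
have := CkM oO (@Ck_cst V R k O (-1)) (CkM oO (CkM oO Cv Cv) (Df v)).
apply: Ck_eq => // x Ox; rewrite deriveV; last exact/diff_derivable/df.
  by rewrite /GRing.scale /= -exprVn expr2 mulN1r mulNr.
exact: f0.
Qed.

Lemma derive_lin V W (f : {linear V -> W}) v x : continuous f -> 'D_v f x = f v.
Proof.
move=> cf; rewrite deriveE; first by rewrite diff_lin.
exact: linear_differentiable.
Qed.

Lemma Ck_lin V W k (O : set V) (f : {linear V -> W}) : continuous f -> Ck k O f.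
Proof.
move=> cf; case: k => [|k]; first by move=> x _; exact: cf.
split=> [x _|v]; first exact: linear_differentiable.
have -> : 'D_v f = (fun=> f v) by rewrite funeqE => x; rewrite derive_lin.
exact: Ck_cst.
Qed.

Lemma differentiable_mx V m n (f : V -> 'M[R]_(m, n)) x :
  (forall i j, differentiable (fun y => f y i j) x) -> differentiable f x.
Proof.
move=> df.
have -> : f = \sum_i \sum_j (fun y => f y i j *: delta_mx i j).
  rewrite funeqE => y; rewrite fct_sumE [LHS]matrix_sum_delta.
  by apply: eq_bigr => i _; rewrite fct_sumE.
apply: differentiable_sum => i; apply: differentiable_sum => j.
exact: differentiableZl.
Qed.

(** Continuity is deduced from differentiability of the entries, at the cost of one
order of differentiability, which smoothness affords. *)
Lemma smooth_mx V m n (O : set V) (f : V -> 'M[R]_(m, n)) : open O ->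
  (forall i j, smooth_on O (fun y => f y i j)) -> smooth_on O f.
Proof.
move=> oO sf k.
have {sf} : forall i j, Ck k.+1 O (fun y => f y i j) by move=> i j; exact: sf.
elim: k f => [|k IH] f Cf.
  move=> x Ox; apply/differentiable_continuous/differentiable_mx => i j.
  by have [d _] := Cf i j; exact: d.
have df x : O x -> differentiable f x.
  by move=> Ox; apply: differentiable_mx => i j; have [d _] := Cf i j; exact: d.
split=> // v.
apply: (@Ck_eq _ _ _ _ (fun x => \matrix_(i, j) 'D_v (fun y => f y i j) x)) => //.
  by move=> x Ox; rewrite derive_mx //; exact/diff_derivable/df.
apply: IH => i j; have [_ /(_ v) D] := Cf i j.
by apply: (@Ck_eq _ _ k.+1 O _ _ oO _ D) => x Ox; rewrite mxE.
Qed.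

Lemma smooth_pair V W W' (O : set V) (f : V -> W) (g : V -> W') : open O ->
  smooth_on O f -> smooth_on O g -> smooth_on O (fun x => (f x, g x)).
Proof.
move=> oO sf sg k; have {sf sg} [] := (sf k.+1, sg k.+1).
elim: k f g => [|k IH] f g [df Df] [dg Dg].
  move=> x Ox; apply/differentiable_continuous/differentiable_pair.
    exact: df.
  exact: dg.
split=> [x Ox|v]; first by apply: differentiable_pair; [exact: df|exact: dg].
apply: Ck_eq (IH _ _ (Df v) (Dg v)) => // x Ox.
have [dfx dgx] := (df x Ox, dg x Ox).
by rewrite [RHS]deriveE ?diff_pair -?deriveE //; exact: differentiable_pair.
Qed.

End RealCalculus.

(** * Rings of functions, and derivatives of complex matrices *)

Section FunctionRing.
Context {R : realType} {V : normedModType R}.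
Local Notation C := R[i].

(** Being C^k on O and being differentiable at a point of O have the same
closure properties.  Stating these once lets every rational expression in matrix
entries be treated for both at the same time. *)
Record function_ring (O : set V) (P : (V -> R) -> Prop) : Prop := FunctionRing {
  fring_eq : forall f g, (forall x, O x -> f x = g x) -> P f -> P g;
  fring_cst : forall a, P (fun=> a);
  fringD : forall f g, P f -> P g -> P (fun x => f x + g x);
  fringM : forall f g, P f -> P g -> P (fun x => f x * g x);
  fringV : forall f, (forall x, O x -> f x != 0) -> P f ->
    P (fun x => (f x)^-1) }.

Lemma Ck_ring k (O : set V) : open O -> function_ring O (@Ck R V R k O).
Proof.
move=> oO; split.
- by move=> f g; exact: Ck_eq.
- by move=> a; exact: Ck_cst.
- by move=> f g; exact: CkD.
- by move=> f g; exact: CkM.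
- by move=> f; exact: CkV.
Qed.

Lemma differentiable_ring (O : set V) (x : V) : open O -> O x ->
  function_ring O (fun f : V -> R => differentiable f x).
Proof.
move=> oO Ox; split.
- move=> f g fg; apply: near_differentiable.
  by apply: filterS fg _; exact: open_nbhs_nbhs.
- by move=> a; exact: differentiable_cst.
- by move=> f g; exact: differentiableD.
- by move=> f g; exact: differentiableM.
- by move=> f f0 df; apply: differentiableV => //; exact: f0.
Qed.

Variables (O : set V) (P : (V -> R) -> Prop).

Definition fring_C (f : V -> C) :=
  P (fun x => complex.Re (f x)) /\ P (fun x => complex.Im (f x)).

Definition fring_mx m n (A : V -> 'M[C]_(m, n)) :=
  forall i j, fring_C (fun x => A x i j).

Hypothesis rP : function_ring O P.

Lemma fring_C_eq f g : (forall x, O x -> f x = g x) -> fring_C f -> fring_C g.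
Proof.
move=> fg [fr fi]; split.
  by apply: (fring_eq rP) fr => x /fg ->.
by apply: (fring_eq rP) fi => x /fg ->.
Qed.

Lemma fring_C_cst a : fring_C (fun=> a).
Proof. by split; exact: fring_cst rP _. Qed.

Lemma fringN f : P f -> P (fun x => - f x).
Proof.
move=> pf; apply: (fring_eq rP) (fringM rP (fring_cst rP (-1)) pf) => x _.
by rewrite mulN1r.
Qed.

Lemma fring_CD f g : fring_C f -> fring_C g -> fring_C (fun x => f x + g x).
Proof.
move=> [fr fi] [gr gi]; split.
  by apply: (fring_eq rP) (fringD rP fr gr) => x _; case: (f x) (g x) => ? ? [].
by apply: (fring_eq rP) (fringD rP fi gi) => x _; case: (f x) (g x) => ? ? [].
Qed.

Lemma fring_CM f g : fring_C f -> fring_C g -> fring_C (fun x => f x * g x).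
Proof.
move=> [fr fi] [gr gi]; split.
  apply: (fring_eq rP) (fringD rP (fringM rP fr gr) (fringN (fringM rP fi gi))).
  by move=> x _; case: (f x) (g x) => ? ? [].
apply: (fring_eq rP) (fringD rP (fringM rP fr gi) (fringM rP fi gr)).
by move=> x _; case: (f x) (g x) => ? ? [].
Qed.

Lemma fring_C_conj f : fring_C f -> fring_C (fun x => (f x)^*).
Proof.
move=> [fr fi]; split.
  by apply: (fring_eq rP) fr => x _; case: (f x).
by apply: (fring_eq rP) (fringN fi) => x _; case: (f x).
Qed.

(** The inverse of a + i b is (a - i b) / (a^2 + b^2). *)
Lemma fring_CV f : (forall x, O x -> f x != 0) -> fring_C f ->
  fring_C (fun x => (f x)^-1).
Proof.
move=> f0 [fr fi].
have pn : P (fun x => (complex.Re (f x) * complex.Re (f x) +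
                       complex.Im (f x) * complex.Im (f x))^-1).
  apply: (fringV rP); last by do 2?apply: (fringD rP); exact: (fringM rP).
  move=> x /f0; case: (f x) => a b /=; rewrite -!expr2 paddr_eq0 ?sqr_ge0 //.
  by rewrite !sqrf_eq0 eq_complex.
split.
  by apply: (fring_eq rP) (fringM rP fr pn) => x _; case: (f x) => a b /=; rewrite -!expr2.
by apply: (fring_eq rP) (fringM rP (fringN fi) pn) => x _; case: (f x) => a b /=; rewrite -!expr2 mulNr.
Qed.

Lemma fring_C_sum I (r : seq I) (Q : pred I) (f : I -> V -> C) :
  (forall i, Q i -> fring_C (f i)) -> fring_C (fun x => \sum_(i <- r | Q i) f i x).
Proof.
move=> pf; elim: r => [|i r IH].
  by apply: fring_C_eq (fring_C_cst 0) => x _; rewrite big_nil.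
have [Qi|Qi] := boolP (Q i).
  apply: fring_C_eq (fring_CD (pf i Qi) IH) => x _.
  by rewrite big_cons Qi.
by apply: fring_C_eq IH => x _; rewrite big_cons (negPf Qi).
Qed.

Lemma fring_C_prod I (r : seq I) (Q : pred I) (f : I -> V -> C) :
  (forall i, Q i -> fring_C (f i)) -> fring_C (fun x => \prod_(i <- r | Q i) f i x).
Proof.
move=> pf; elim: r => [|i r IH].
  by apply: fring_C_eq (fring_C_cst 1) => x _; rewrite big_nil.
have [Qi|Qi] := boolP (Q i).
  apply: fring_C_eq (fring_CM (pf i Qi) IH) => x _.
  by rewrite big_cons Qi.
by apply: fring_C_eq IH => x _; rewrite big_cons (negPf Qi).
Qed.

Lemma fring_mx_eq m n (A B : V -> 'M[C]_(m, n)) :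
  (forall x, O x -> A x = B x) -> fring_mx A -> fring_mx B.
Proof. by move=> AB pA i j; apply: fring_C_eq (pA i j) => x /AB ->. Qed.

Lemma fring_mx_cst m n (A : 'M[C]_(m, n)) : fring_mx (fun=> A).
Proof. by move=> i j; exact: fring_C_cst. Qed.

Lemma fring_mxD m n (A B : V -> 'M[C]_(m, n)) :
  fring_mx A -> fring_mx B -> fring_mx (fun x => A x + B x).
Proof.
by move=> pA pB i j; apply: fring_C_eq (fring_CD (pA i j) (pB i j)) => x _; rewrite mxE.
Qed.

Lemma fring_mxM m n p (A : V -> 'M[C]_(m, n)) (B : V -> 'M[C]_(n, p)) :
  fring_mx A -> fring_mx B -> fring_mx (fun x => A x *m B x).
Proof.
move=> pA pB i j; apply: (@fring_C_eq (fun x => \sum_k A x i k * B x k j)).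
  by move=> x _; rewrite mxE.
by apply: fring_C_sum => k _; exact: fring_CM.
Qed.

Lemma fring_mxN m n (A : V -> 'M[C]_(m, n)) :
  fring_mx A -> fring_mx (fun x => - A x).
Proof.
move=> pA i j; apply: fring_C_eq (fring_CM (fring_C_cst (-1)) (pA i j)) => x _.
by rewrite mxE mulN1r.
Qed.

Lemma fring_mx_adj m n (A : V -> 'M[C]_(m, n)) :
  fring_mx A -> fring_mx (fun x => (A x)^t*).
Proof.
by move=> pA i j; apply: fring_C_eq (fring_C_conj (pA j i)) => x _; rewrite !mxE.
Qed.

Lemma fring_mxvec m n (A : V -> 'M[C]_(m, n)) :
  fring_mx A -> fring_mx (fun x => mxvec (A x)).
Proof.
move=> pA i k; case/mxvec_indexP: k => j l.
by apply: fring_C_eq (pA j l) => x _; rewrite ord1 mxvecE.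
Qed.

Lemma fring_vec_mx m n (A : V -> 'rV[C]_(m * n)) :
  fring_mx A -> fring_mx (fun x => vec_mx (A x)).
Proof.
by move=> pA i j; apply: fring_C_eq (pA 0 (mxvec_index i j)) => x _; rewrite !mxE.
Qed.

Lemma fring_det n (A : V -> 'M[C]_n) :
  fring_mx A -> fring_C (fun x => \det (A x)).
Proof.
move=> pA; apply: fring_C_sum => s _; apply: fring_CM; first exact: fring_C_cst.
by apply: fring_C_prod => i _; exact: pA.
Qed.

(** The entries of the inverse are cofactors divided by the determinant. *)
Lemma fring_invmx n (A : V -> 'M[C]_n) : (forall x, O x -> A x \in unitmx) ->
  fring_mx A -> fring_mx (fun x => invmx (A x)).
Proof.
move=> uA pA i j.
apply: (@fring_C_eq (fun x => (\det (A x))^-1 * cofactor (A x) j i)).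
  by move=> x /uA ux; rewrite /invmx ux !mxE.
apply: fring_CM.
  apply: fring_CV; last exact: fring_det.
  by move=> x /uA; rewrite unitmxE unitfE.
apply: fring_CM; first exact: fring_C_cst.
apply: fring_det => k l.
by apply: fring_C_eq (pA (lift j k) (lift i l)) => x _; rewrite !mxE.
Qed.

End FunctionRing.

Section ComplexDerivative.
Context {R : realType}.
Local Notation C := R[i].
Implicit Types V W : normedModType R.

Definition diffmx V m n (A : V -> 'M[C]_(m, n)) (x : V) : Prop :=
  fring_mx (fun f => differentiable f x) A.

Definition derivmx V m n (A : V -> 'M[C]_(m, n)) (x v : V) : 'M[C]_(m, n) :=
  \matrix_(i, j) derivC (fun y => A y i j) x v.

Lemma derive_diff_comp V W (W' : normedModType R) (f : V -> W)
    (L : {linear W -> W'}) x v :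
  differentiable f x -> continuous L -> 'D_v (L \o f) x = L ('D_v f x).
Proof.
move=> df cL; have dL : differentiable L (f x) by exact: linear_differentiable.
rewrite !deriveE //; last exact: differentiable_comp.
by rewrite diff_comp //= diff_lin.
Qed.

Lemma diff_ring V (x : V) :
  function_ring setT (fun f : V -> R => differentiable f x).
Proof. exact: differentiable_ring openT _. Qed.

Local Notation diffC f x := (fring_C (fun g => differentiable g x) f).

Lemma derivC_near V (f g : V -> C) x v :
  (\forall y \near x, f y = g y) -> derivC f x v = derivC g x v.
Proof.
move=> fg; rewrite /derivC; congr (_ +i* _)%C; apply: near_eq_derive.
  by apply: filterS fg => y ->.
by apply: filterS fg => y ->.
Qed.

Lemma derivC_cst V (a : C) (x v : V) : derivC (fun=> a) x v = 0.
Proof. by rewrite /derivC !derive_cst. Qed.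

Lemma derivCD V (f g : V -> C) x v : diffC f x -> diffC g x ->
  derivC (fun y => f y + g y) x v = derivC f x v + derivC g x v.
Proof.
move=> [fr fi] [gr gi]; rewrite /derivC.
rewrite -[RHS]/((_ + _) +i* (_ + _))%C.
rewrite -deriveD -?deriveD; try exact: diff_derivable.
by congr ('D_v _ x +i* 'D_v _ x)%C; apply/funext => y; rewrite !fctE /=;
  case: (f y) (g y) => ? ? [].
Qed.

Lemma derivCM V (f g : V -> C) x v : diffC f x -> diffC g x ->
  derivC (fun y => f y * g y) x v = derivC f x v * g x + f x * derivC g x v.
Proof.
move=> [fr fi] [gr gi]; rewrite /derivC.
have -> : (fun y => complex.Re (f y * g y)) =
   (fun y => complex.Re (f y)) * (fun y => complex.Re (g y)) -
   (fun y => complex.Im (f y)) * (fun y => complex.Im (g y)).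
  by apply/funext => y; rewrite !fctE /=; case: (f y) (g y) => ? ? [].
have -> : (fun y => complex.Im (f y * g y)) =
   (fun y => complex.Re (f y)) * (fun y => complex.Im (g y)) +
   (fun y => complex.Im (f y)) * (fun y => complex.Re (g y)).
  by apply/funext => y; rewrite !fctE /=; case: (f y) (g y) => ? ? [].
have d := @diff_derivable R V _ _ x v.
rewrite deriveB ?deriveD ?deriveM; try exact: d;
  try (by apply: derivableM; exact: d).
rewrite /GRing.scale /=.
move: ('D_v _ x) ('D_v _ x) ('D_v _ x) ('D_v _ x) => da' db' da db.
by case: (f x) (g x) => a b [a' b'] /=; congr (_ +i* _)%C; ring.
Qed.

Lemma derivC_conj V (f : V -> C) x v : diffC f x ->
  derivC (fun y => (f y)^*) x v = (derivC f x v)^*.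
Proof.
move=> [fr fi]; rewrite /derivC.
have -> : (fun y => complex.Im ((f y)^*)) = - (fun y => complex.Im (f y)).
  by apply/funext => y; rewrite !fctE; case: (f y).
have -> : (fun y => complex.Re ((f y)^*)) = (fun y => complex.Re (f y)).
  by apply/funext => y; case: (f y).
by rewrite deriveN //; exact: diff_derivable.
Qed.

Lemma derivC_sum V I (r : seq I) (Q : pred I) (f : I -> V -> C) x v :
  (forall i, diffC (f i) x) ->
  derivC (fun y => \sum_(i <- r | Q i) f i y) x v =
  \sum_(i <- r | Q i) derivC (f i) x v.
Proof.
have rD := diff_ring x.
move=> df; elim: r => [|i r IH].
  rewrite big_nil -[RHS](derivC_cst 0 x v); congr (derivC _ x v).
  by apply/funext => y; rewrite big_nil.
rewrite big_cons -IH.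
transitivity (derivC (fun y => if Q i then f i y + \sum_(j <- r | Q j) f j y
                               else \sum_(j <- r | Q j) f j y) x v).
  by congr (derivC _ x v); apply/funext => y; rewrite big_cons.
case: ifP => // _; apply: derivCD => //.
by apply: (fring_C_sum rD).
Qed.

Lemma derivmx_near V m n (A B : V -> 'M[C]_(m, n)) x v :
  (\forall y \near x, A y = B y) -> derivmx A x v = derivmx B x v.
Proof.
move=> AB; apply/matrixP => i j; rewrite !mxE; apply: derivC_near.
by apply: filterS AB => y ->.
Qed.

Lemma derivmx_cst V m n (A : 'M[C]_(m, n)) (x v : V) : derivmx (fun=> A) x v = 0.
Proof. by apply/matrixP => i j; rewrite !mxE derivC_cst. Qed.

Lemma derivmxD V m n (A B : V -> 'M[C]_(m, n)) x v : diffmx A x -> diffmx B x ->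
  derivmx (fun y => A y + B y) x v = derivmx A x v + derivmx B x v.
Proof.
move=> dA dB; apply/matrixP => i j; rewrite !mxE -derivCD //.
by congr (derivC _ x v); apply/funext => y; rewrite mxE.
Qed.

Lemma derivmxM V m n p (A : V -> 'M[C]_(m, n)) (B : V -> 'M[C]_(n, p)) x v :
  diffmx A x -> diffmx B x ->
  derivmx (fun y => A y *m B y) x v = derivmx A x v *m B x + A x *m derivmx B x v.
Proof.
move=> dA dB; apply/matrixP => i j; rewrite !mxE.
transitivity (derivC (fun y => \sum_k A y i k * B y k j) x v).
  by congr (derivC _ x v); apply/funext => y; rewrite mxE.
have rD := diff_ring x.
rewrite derivC_sum; last by move=> k; exact: (fring_CM rD).
rewrite -big_split; apply: eq_bigr => k _.
by rewrite derivCM // !mxE.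
Qed.

Lemma derivmx_adj V m n (A : V -> 'M[C]_(m, n)) x v : diffmx A x ->
  derivmx (fun y => (A y)^t*) x v = (derivmx A x v)^t*.
Proof.
move=> dA; apply/matrixP => i j; rewrite !mxE -derivC_conj //.
by congr (derivC _ x v); apply/funext => y; rewrite !mxE.
Qed.

Definition ofC m n (A : 'M[C]_(m, n)) : cmx R m n :=
  (\matrix_(i, j) complex.Re (A i j), \matrix_(i, j) complex.Im (A i j)).

Lemma ofCK m n : cancel (@ofC m n) (@toC R m n).
Proof. by move=> A; apply/matrixP => i j; rewrite !mxE; case: (A i j). Qed.

Lemma toCK m n : cancel (@toC R m n) (@ofC m n).
Proof.
by move=> [a b]; congr pair; apply/matrixP => i j; rewrite !mxE.
Qed.

Lemma smooth_ofC V m n (O : set V) (A : V -> 'M[C]_(m, n)) : open O ->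
  (forall k, fring_mx (@Ck R V R k O) A) -> smooth_on O (fun x => ofC (A x)).
Proof.
move=> oO sA; apply: smooth_pair => //.
  apply: smooth_mx => // i j k; have [+ _] := sA k i j.
  by apply: Ck_eq => // x _; rewrite mxE.
apply: smooth_mx => // i j k; have [_ +] := sA k i j.
by apply: Ck_eq => // x _; rewrite mxE.
Qed.

Lemma coord_linear m n (i : 'I_m) (j : 'I_n) :
  linear (fun M : 'M[R]_(m, n) => M i j).
Proof. by move=> a u v; rewrite !mxE. Qed.

Definition coordmx m n i j : {linear 'M[R]_(m, n) -> R} :=
  HB.pack (fun M : 'M[R]_(m, n) => M i j)
    (GRing.isLinear.Build R 'M[R]_(m, n) R _ _ (coord_linear i j)).


Lemma continuous_coord1 m n i j : continuous (@coordmx m n i j \o fst : cmx R m n -> R).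
Proof.
move=> x; apply: (@continuous_comp _ _ _ fst (fun M : 'M[R]_(m, n) => M i j)).
  exact: cvg_fst.
exact: coord_continuous.
Qed.

Lemma continuous_coord2 m n i j : continuous (@coordmx m n i j \o snd : cmx R m n -> R).
Proof.
move=> x; apply: (@continuous_comp _ _ _ snd (fun M : 'M[R]_(m, n) => M i j)).
  exact: cvg_snd.
exact: coord_continuous.
Qed.

Lemma toC_Ck V m n k (O : set V) (L : {linear V -> cmx R m n}) : continuous L ->
  fring_mx (@Ck R V R k O) (fun x => toC (L x)).
Proof.
move=> cL i j; split.
  have -> : (fun x => complex.Re (toC (L x) i j)) = @coordmx m n i j \o fst \o L.
    by apply/funext => x; rewrite !mxE.
  apply: Ck_lin => x; apply: continuous_comp; [exact: cL|exact: continuous_coord1].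
have -> : (fun x => complex.Im (toC (L x) i j)) = @coordmx m n i j \o snd \o L.
  by apply/funext => x; rewrite !mxE.
apply: Ck_lin => x; apply: continuous_comp; [exact: cL|exact: continuous_coord2].
Qed.

Lemma diffmx_toC V m n (f : V -> cmx R m n) x : differentiable f x ->
  diffmx (fun y => toC (f y)) x.
Proof.
move=> df i j; split.
  have -> : (fun x => complex.Re (toC (f x) i j)) = (@coordmx m n i j \o fst) \o f.
    by apply/funext => y; rewrite !mxE.
  apply: differentiable_comp => //; apply: linear_differentiable.
  exact: continuous_coord1.
have -> : (fun x => complex.Im (toC (f x) i j)) = (@coordmx m n i j \o snd) \o f.
  by apply/funext => y; rewrite !mxE.
apply: differentiable_comp => //; apply: linear_differentiable.
exact: continuous_coord2.
Qed.

Lemma derivmx_toC V m n (f : V -> cmx R m n) x v : differentiable f x ->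
  derivmx (fun y => toC (f y)) x v = toC ('D_v f x).
Proof.
move=> df; apply/matrixP => i j; rewrite !mxE /derivC.
have -> : (fun x => complex.Re (toC (f x) i j)) = (@coordmx m n i j \o fst) \o f.
  by apply/funext => y; rewrite !mxE.
have -> : (fun x => complex.Im (toC (f x) i j)) = (@coordmx m n i j \o snd) \o f.
  by apply/funext => y; rewrite !mxE.
rewrite !derive_diff_comp //; first exact: continuous_coord2.
exact: continuous_coord1.
Qed.

End ComplexDerivative.

(** * Smoothness of the square root *)

Section SquareRoot.
Context {R : realType}.
Local Notation C := R[i].

(** The positive definite square root; it is unique, so that the choice made by
[xget] is forced, and the default value 0 is taken off the positive definite
matrices. *)
Definition sqrtmx n (K : 'M[C]_n) : 'M[C]_n :=
  xget 0 [set S | posdef S /\ S *m S = K].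

Lemma sqrtmxP n (K : 'M[C]_n) : posdef K ->
  posdef (sqrtmx K) /\ sqrtmx K *m sqrtmx K = K.
Proof.
move=> /posdef_sqrt_exists [S pS SK]; rewrite /sqrtmx.
by case: xgetP => [T _ //|/(_ S) []].
Qed.

Lemma sqrtmxE n (S : 'M[C]_n) : posdef S -> sqrtmx (S *m S) = S.
Proof.
move=> pS; have pSS : posdef (S *m S).
  by have [hS _] := pS; rewrite -{1}hS; apply: posdef_gram; exact: posdef_unit.
have [pT TT] := sqrtmxP pSS; exact: posdef_sqrt_unique.
Qed.

(** The equivariance that makes the polar decomposition descend to the
quotients. *)
Lemma sqrtmx_congr n (K h : 'M[C]_n) : h \is unitarymx -> posdef K ->
  sqrtmx (h^t* *m K *m h) = h^t* *m sqrtmx K *m h.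
Proof.
move=> uh pK; have [pS SS] := sqrtmxP pK.
rewrite -[RHS]sqrtmxE; last by apply: posdef_congr => //; exact: unitarymx_unit.
congr sqrtmx; rewrite !mulmxA -(mulmxA _ h (h^t*)) (unitarymxPr uh) mulmx1.
by rewrite -(mulmxA _ (sqrtmx K) (sqrtmx K)) SS.
Qed.

Lemma derivC_tr (V : normedModType R) n (A : V -> 'M[C]_n) x v : diffmx A x ->
  derivC (fun y => \tr (A y)) x v = \tr (derivmx A x v).
Proof.
move=> dA; rewrite derivC_sum; last by move=> i; exact: dA.
by apply: eq_bigr => i _; rewrite mxE.
Qed.

Lemma norm_Re_le (z w : C) : `|z| <= w -> `|complex.Re z| <= complex.Re w.
Proof. by move=> zw; have := le_trans (normc_ge_Re z) zw; rewrite lecE => /andP[]. Qed.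

Lemma norm_Im_le (z w : C) : `|z| <= w -> `|complex.Im z| <= complex.Re w.
Proof.
move=> zw; have -> : complex.Im z = complex.Re (- 'i%C * z).
  by case: z {zw} => a b /=; ring.
apply: norm_Re_le; rewrite normrM normrN (normc_def 'i%C) /=.
by rewrite expr0n expr1n add0r sqrtr1 mul1r.
Qed.

(** Solving the equation for X = S y - S x with the operator at the fixed point
x expresses S y as an affine function of E y - X^2, where E y = K y - K x.  The
entries of X^2 are bounded by |X|^2, hence by a multiple of |E|^2, which vanishes
to first order at x. *)
Lemma sqrtmx_diff (V : normedModType R) n (O : set V) (K : V -> 'M[C]_n) (x : V) :
  open O -> O x -> (forall y, O y -> posdef (K y)) -> diffmx K x ->
  diffmx (fun y => sqrtmx (K y)) x.
Proof.
move=> oO Ox pK dK; pose S y := sqrtmx (K y).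
have pS y : O y -> posdef (S y) by move=> /pK /sqrtmxP [].
have SS y : O y -> S y *m S y = K y by move=> /pK /sqrtmxP [].
have rD := differentiable_ring oO Ox.
pose E y := K y - K x; pose X y := S y - S x.
have dE : diffmx E x by apply: (fring_mxD rD) => //; exact: (fring_mx_cst rD).
have [c c0 bX] := sylvester_bound (pS x Ox).
have {}bX y : O y -> sqnorm (X y) <= c ^- 2 * sqnorm (E y).
  move=> Oy; rewrite -(ler_pM2l (exprn_gt0 2 c0)) mulVKf ?expf_neq0 ?gt_eqF //.
  apply: (bX (S y)); first exact: pS.
  by rewrite mulmxBr mulmxBl addrA subrK !SS.
pose G y := c ^- 2 * \tr (E y *m (E y)^t*).
have dEE : diffmx (fun y => E y *m (E y)^t*) x.
  by apply: (fring_mxM rD) => //; exact: (fring_mx_adj rD).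
have dG : fring_C (fun g => differentiable g x) G.
  apply: (fring_CM rD); first exact: (fring_C_cst rD).
  by apply: (fring_C_sum rD) => i _; exact: dEE.
have Ex0 : E x = 0 by rewrite /E subrr.
have Gx0 : G x = 0 by rewrite /G Ex0 mul0mx mxtrace0 mulr0.
have DG v : derivC G x v = 0.
  rewrite derivCM; last 2 first.
  - exact: (fring_C_cst rD).
  - by apply: (fring_C_sum rD) => i _; exact: dEE.
  rewrite derivC_cst mul0r add0r derivC_tr // derivmxM //; last exact: (fring_mx_adj rD).
  by rewrite Ex0 adj0 mul0mx mulmx0 addr0 mxtrace0 mulr0.
(* Everything bounded by |X|^2 is differentiable at x. *)
have small (f : V -> C) : (forall y, O y -> `|f y| <= sqnorm (X y)) ->
    fring_C (fun g => differentiable g x) f.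
  move=> fX.
  have [rG _] := dG.
  have q0 : complex.Re (G x) = 0 by rewrite Gx0.
  have Dq v : 'D_v (fun y => complex.Re (G y)) x = 0.
    by have := congr1 (@complex.Re R) (DG v).
  have nO : nbhs x O by exact: open_nbhs_nbhs.
  split; apply: small_differentiable rG q0 Dq; apply: filterS nO => y Oy.
    by apply: norm_Re_le; apply: le_trans (fX y Oy) (bX y Oy).
  by apply: norm_Im_le; apply: le_trans (fX y Oy) (bX y Oy).
have dXX : diffmx (fun y => X y *m X y) x.
  move=> i j; apply: (fring_C_eq rD (f := fun y => \sum_k X y i k * X y k j)).
    by move=> y _; rewrite mxE.
  apply: (fring_C_sum rD) => k _; apply: small => y _.
  by rewrite normrM; exact: sqnorm_entry2.
apply: (fring_mx_eq rD
  (A := fun y => S x + vec_mx (mxvec (E y - X y *m X y) *m invmx (sylvester (S x))))).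
  move=> y Oy; have SX : S x *m X y + X y *m S x = E y - X y *m X y.
    apply/(canRL (addrK _)); rewrite addrAC -mulmxDl (addrC (S x)) subrK.
    by rewrite mulmxBr mulmxBl addrA subrK !SS.
  by rewrite -(sylvester_solve (pS x Ox) SX) addrC subrK.
apply: (fring_mxD rD); first exact: (fring_mx_cst rD).
apply/(fring_vec_mx rD)/(fring_mxM rD); last exact: (fring_mx_cst rD).
by apply/(fring_mxvec rD)/(fring_mxD rD) => //; exact: (fring_mxN rD).
Qed.

Lemma derivmx_sqrtmx (V : normedModType R) n (O : set V) (K : V -> 'M[C]_n) (x v : V) :
  open O -> O x -> (forall y, O y -> posdef (K y)) -> diffmx K x ->
  sqrtmx (K x) *m derivmx (fun y => sqrtmx (K y)) x v +
    derivmx (fun y => sqrtmx (K y)) x v *m sqrtmx (K x) = derivmx K x v.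
Proof.
move=> oO Ox pK dK; have dS := sqrtmx_diff oO Ox pK dK.
rewrite addrC -derivmxM //; apply: derivmx_near.
have nO : nbhs x O by exact: open_nbhs_nbhs.
by apply: filterS nO => y /pK /sqrtmxP [].
Qed.

(** The rows are the images of the elementary matrices. *)
Lemma fring_sylvester (V : normedModType R) n (O : set V) P (S : V -> 'M[C]_n) :
  function_ring O P -> fring_mx P S -> fring_mx P (fun x => sylvester (S x)).
Proof.
move=> rP pS i j.
pose D : 'M[C]_n := vec_mx (delta_mx 0 i).
apply: (fring_C_eq rP (f := fun x => mxvec (S x *m D + D *m S x) 0 j)).
  by move=> x _; rewrite -sylvesterE vec_mxK -rowE mxE.
apply: (fring_mxvec rP); apply: (fring_mxD rP); apply: (fring_mxM rP) => //;
  exact: (fring_mx_cst rP).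
Qed.

(** The derivative solves a Sylvester equation with coefficients of class C^k as
soon as the square root is of class C^k, whence the next order. *)
Lemma sqrtmx_Ck (V : normedModType R) n (O : set V) (K : V -> 'M[C]_n) : open O ->
  (forall y, O y -> posdef (K y)) -> (forall k, fring_mx (@Ck R V R k O) K) ->
  forall k, fring_mx (@Ck R V R k O) (fun y => sqrtmx (K y)).
Proof.
move=> oO pK sK.
have dK x : O x -> diffmx K x.
  by move=> Ox i j; have [[dr _] [di _]] := sK 1 i j; split; [exact: dr|exact: di].
have dS x (Ox : O x) := sqrtmx_diff oO Ox pK (dK x Ox).
elim=> [|k IH].
  move=> i j; split=> x Ox; have [dr di] := dS x Ox i j;
    exact: differentiable_continuous.
have rP := Ck_ring k oO.
have DS v : fring_mx (@Ck R V R k O) (fun x => derivmx (fun y => sqrtmx (K y)) x v).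
  apply: (fring_mx_eq rP (A := fun x =>
    vec_mx (mxvec (derivmx K x v) *m invmx (sylvester (sqrtmx (K x)))))).
    move=> x Ox; have [pS _] := sqrtmxP (pK x Ox).
    apply/esym/sylvester_solve => //; exact: derivmx_sqrtmx oO Ox pK (dK x Ox).
  apply/(fring_vec_mx rP)/(fring_mxM rP).
    apply: (fring_mxvec rP) => i j; have [[_ /(_ v) dr] [_ /(_ v) di]] := sK k.+1 i j.
    apply: (fring_C_eq rP (f := fun x => derivC (fun y => K y i j) x v)) => //.
    by move=> x _; rewrite mxE.
  apply: (fring_invmx rP); last exact: (fring_sylvester rP).
  by move=> x Ox; have [pS _] := sqrtmxP (pK x Ox); exact: sylvester_unit.
move=> i j; split.
  split=> [x Ox|v]; first by have [dr _] := dS x Ox i j.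
  have [+ _] := DS v i j; apply: (Ck_eq oO) => x _.
  by rewrite mxE.
split=> [x Ox|v]; first by have [_ di] := dS x Ox i j.
have [_ +] := DS v i j; apply: (Ck_eq oO) => x _.
by rewrite mxE.
Qed.

End SquareRoot.

(** * The two trace identities and block-diagonal matrices *)

Section Algebra.
Context {C : numClosedFieldType}.

(** With Z = U S, the tangent vectors (A1, A2) and (B1, B2) at (U, K) move Z by
A1 S + U X and B1 S + U Y, where X and Y are the variations of S.  The terms
tr (X Y) cancel by antisymmetry, and the cross terms combine to the variation of K
because U^H A1 and U^H B1 are anti-Hermitian. *)
Lemma polar_trace n (U S K A1 A2 X B1 B2 Y : 'M[C]_n) :
  U^t* *m U = 1%:M -> S^t* = S -> S *m S = K ->
  A1^t* *m U + U^t* *m A1 = 0 -> B1^t* *m U + U^t* *m B1 = 0 ->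
  X^t* = X -> Y^t* = Y ->
  S *m X + X *m S = A2 -> S *m Y + Y *m S = B2 ->
  \tr ((A1 *m S + U *m X)^t* *m (B1 *m S + U *m Y)) -
  \tr ((B1 *m S + U *m Y)^t* *m (A1 *m S + U *m X)) =
  \tr (K *m (A1^t* *m B1 - B1^t* *m A1)) +
  (\tr (A2 *m (U^t* *m B1)) - \tr (B2 *m (U^t* *m A1))).
Proof.
move=> UU hS SK tA tB hX hY XA YB.
have expand (A B X' Y' : 'M[C]_n) : X'^t* = X' -> A^t* *m U + U^t* *m A = 0 ->
    \tr ((A *m S + U *m X')^t* *m (B *m S + U *m Y')) =
    \tr (K *m (A^t* *m B)) - \tr (Y' *m S *m (U^t* *m A)) +
    \tr (S *m X' *m (U^t* *m B)) + \tr (X' *m Y').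
  move=> hX' tA'; have {tA'} AU : A^t* *m U = - (U^t* *m A) by apply/eqP; rewrite -addr_eq0 tA'.
  rewrite adjD !adjM hS hX' mulmxDl !mulmxDr !mxtraceD addrA.
  congr (_ + _ + _ + _).
  - by rewrite !mulmxA mxtrace_mulC -SK !mulmxA.
  - rewrite -mulmxA (mulmxA _ U) AU mulNmx mulmxN raddfN /=; congr (- _).
    by rewrite !mulmxA mxtrace_mulC !mulmxA.
  - by rewrite !mulmxA mxtrace_mulC !mulmxA.
  - by rewrite !mulmxA -(mulmxA X') UU mulmx1.
rewrite !expand // -XA -YB mulmxBr !mulmxDl !raddfB !raddfD /=.
rewrite (mxtrace_mulC Y X).
ring.
Qed.

Lemma mul_adj_unitary n (h A B : 'M[C]_n) : h \is unitarymx ->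
  \tr ((A *m h)^t* *m (B *m h)) = \tr (A^t* *m B).
Proof.
move=> uh; rewrite adjM -mulmxA mxtrace_mulC !mulmxA -!mulmxA unitarymxPr //.
by rewrite mulmx1.
Qed.

End Algebra.

Section Blocks.
Context {C : numClosedFieldType} {r : nat} {d : 'I_r.+1 -> nat}.
Local Notation n := (\sum_i d i)%N.
Implicit Types A B M h : 'M[C]_n.

Definition blockdiag A := forall i j, i != j -> submxblock A i j = 0.
(** The variations of a matrix with fixed diagonal blocks. *)
Definition offblock A := forall i, submxblock A i i = 0.

Lemma submxblockM A B i k :
  submxblock (A *m B) i k = \sum_j submxblock A i j *m submxblock B j k.
Proof.
rewrite -{1}(submxblockK A) -{1}(submxblockK B) mul_mxblock mxblockK.
by [].
Qed.

Lemma submxblock_adj A i j : submxblock (A^t*) i j = (submxblock A j i)^t*.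
Proof. by apply/matrixP => k l; rewrite !mxE. Qed.

Lemma mx_entry_block A a b :
  A a b = submxblock A (tagnat.sig1 a) (tagnat.sig1 b) (tagnat.sig2 a) (tagnat.sig2 b).
Proof. by rewrite mxE !tagnat.sig2K. Qed.

Lemma blockdiag_adj A : blockdiag A -> blockdiag (A^t*).
Proof. by move=> dA i j ij; rewrite submxblock_adj dA ?adj0 // eq_sym. Qed.

Lemma blockdiagM A B : blockdiag A -> blockdiag B -> blockdiag (A *m B).
Proof.
move=> dA dB i k ik; rewrite submxblockM big1 // => j _.
by have [->|ij] := eqVneq j i; [rewrite dB ?mulmx0|rewrite dA ?mul0mx // eq_sym].
Qed.

Lemma blockdiag1 : blockdiag 1%:M.
Proof. by move=> i j ij; rewrite -mxdiagZ /mxdiag mxblockK (negPf ij). Qed.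

Lemma submxblock1 i : submxblock (1%:M : 'M[C]_n) i i = 1%:M.
Proof. by rewrite -mxdiagZ submxblock_diag. Qed.

Lemma blockdiag_block A B i : blockdiag A ->
  submxblock (A *m B) i i = submxblock A i i *m submxblock B i i.
Proof.
by move=> dA; rewrite submxblockM (bigD1 i) //= big1 ?addr0 // => j ji; rewrite dA ?mul0mx // eq_sym.
Qed.

(** The trace form pairs each block with the transposed one. *)
Lemma blockdiag_offblock_tr A M : blockdiag A -> offblock M -> \tr (A *m M) = 0.
Proof.
move=> dA oM; apply: big1 => a _; rewrite mxE; apply: big1 => b _.
rewrite (mx_entry_block A) (mx_entry_block M).
have [ab|ab] := eqVneq (tagnat.sig1 a) (tagnat.sig1 b); last by rewrite dA // [X in X * _]mxE mul0r.
have oM' i j : i = j -> submxblock M i j = 0 by move=> ->; exact: oM.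
by rewrite oM' // [X in _ * X]mxE mulr0.
Qed.

Lemma blockdiag_comm (c : 'I_r.+1 -> C) A : blockdiag A ->
  (\mxdiag_i (c i)%:M) *m A = A *m (\mxdiag_i (c i)%:M).
Proof.
move=> dA; rewrite -{1 2}(submxblockK A) mul_mxdiag_mxblock mul_mxblock_mxdiag.
apply: eq_mxblock => i j.
have [->|ij] := eqVneq i j; last by rewrite dA // mulmx0 mul0mx.
by rewrite scalar_mxC.
Qed.

(** Invariance of tr (dZ^H /\ dZ) under Z |-> Z h, where a and b are the
variations of h.  With a' = a h^H the moved vector is (v + Z a') h, and h drops out
by unitarity.  What remains besides the right-hand side is the pairing of a' and
b' with the variations of Z^H Z, whose diagonal blocks vanish, and a term
tr (b' Z^H Z a') - tr (a' Z^H Z b').  Only the diagonal blocks of Z^H Z count in the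
latter, and these are scalar. *)
Lemma gauge_trace (c : 'I_r.+1 -> C) (Z v w h a b : 'M[C]_n) :
  h \is unitarymx -> blockdiag h -> blockdiag a -> blockdiag b ->
  a^t* *m h + h^t* *m a = 0 -> b^t* *m h + h^t* *m b = 0 ->
  (forall i, submxblock (Z^t* *m Z) i i = (c i)%:M) ->
  offblock (v^t* *m Z + Z^t* *m v) -> offblock (w^t* *m Z + Z^t* *m w) ->
  \tr ((v *m h + Z *m a)^t* *m (w *m h + Z *m b)) -
  \tr ((w *m h + Z *m b)^t* *m (v *m h + Z *m a)) =
  \tr (v^t* *m w) - \tr (w^t* *m v).
Proof.
move=> uh dh da db ta tb ZZ ov ow.
(* Right translation of the variation of h to the identity. *)
have frame (x e : 'M[C]_n) : blockdiag e -> e^t* *m h + h^t* *m e = 0 ->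
    exists e', [/\ blockdiag e', e'^t* = - e' & x *m h + Z *m e = (x + Z *m e') *m h].
  move=> de te; exists (e *m h^t*); split.
  - by apply: blockdiagM => //; exact: blockdiag_adj.
  - rewrite adjM trmxCK; apply/eqP; rewrite -addr_eq0; apply/eqP.
    have := congr1 (fun x => h *m x *m h^t*) te.
    rewrite mulmx0 mul0mx mulmxDr mulmxDl !mulmxA unitarymxPr // mul1mx.
    by rewrite -(mulmxA _ h) unitarymxPr // mulmx1.
  - by rewrite mulmxDl -!mulmxA unitarymxPl // mulmx1.
have [a' [{}da ha ->]] := frame v a da ta.
have [b' [{}db hb ->]] := frame w b db tb.
rewrite !mul_adj_unitary //; clear a b ta tb frame; rename a' into a; rename b' into b.
pose D : 'M[C]_n := \mxdiag_i ((c i)%:M : 'M[C]_(d i)).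
have oM : offblock (Z^t* *m Z - D).
  by move=> i; rewrite submxblockB ZZ submxblock_diag subrr.
have expand (x y e f : 'M[C]_n) : e^t* = - e ->
    \tr ((x + Z *m e)^t* *m (y + Z *m f)) =
    \tr (x^t* *m y) + \tr (f *m (x^t* *m Z)) - \tr (e *m (Z^t* *m y)) -
    \tr (e *m (Z^t* *m Z) *m f).
  move=> he; rewrite adjD adjM he mulmxDl !mulmxDr !mxtraceD addrA.
  rewrite !mulNmx !raddfN /=; congr (_ + _ - _ - _).
  - by rewrite mulmxA mxtrace_mulC.
  - by rewrite mulmxA.
  - by rewrite !mulmxA.
rewrite !expand //.
have ev := blockdiag_offblock_tr db ov; have ew := blockdiag_offblock_tr da ow.
rewrite mulmxDr mxtraceD in ev; rewrite mulmxDr mxtraceD in ew.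
have sym : \tr (a *m (Z^t* *m Z) *m b) = \tr (b *m (Z^t* *m Z) *m a).
  rewrite -[Z^t* *m Z](subrK D); move: (_ - D) oM => M oM.
  rewrite !mulmxDr !mulmxDl !mxtraceD; congr (_ + _).
    rewrite mxtrace_mulC mulmxA [RHS]mxtrace_mulC mulmxA.
    by rewrite !blockdiag_offblock_tr //; exact: blockdiagM.
  by rewrite -(blockdiag_comm c da) mxtrace_mulC !mulmxA.
rewrite sym.
move: ev ew => /eqP; rewrite addr_eq0 => /eqP -> /eqP; rewrite addr_eq0 => /eqP ->.
ring.
Qed.

(** Both identities at once, for a point U S that equals Z up to a
block-unitary factor. *)
Lemma polar_gauge_trace (c : 'I_r.+1 -> C)
    (U S K A1 A2 X B1 B2 Y Z v w h a b : 'M[C]_n) :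
  U^t* *m U = 1%:M -> S^t* = S -> S *m S = K ->
  A1^t* *m U + U^t* *m A1 = 0 -> B1^t* *m U + U^t* *m B1 = 0 ->
  X^t* = X -> Y^t* = Y ->
  S *m X + X *m S = A2 -> S *m Y + Y *m S = B2 ->
  h \is unitarymx -> blockdiag h -> blockdiag a -> blockdiag b ->
  a^t* *m h + h^t* *m a = 0 -> b^t* *m h + h^t* *m b = 0 ->
  (forall i, submxblock (Z^t* *m Z) i i = (c i)%:M) ->
  offblock (v^t* *m Z + Z^t* *m v) -> offblock (w^t* *m Z + Z^t* *m w) ->
  A1 *m S + U *m X = v *m h + Z *m a -> B1 *m S + U *m Y = w *m h + Z *m b ->
  \tr (K *m (A1^t* *m B1 - B1^t* *m A1)) +
  (\tr (A2 *m (U^t* *m B1)) - \tr (B2 *m (U^t* *m A1))) =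
  \tr (v^t* *m w) - \tr (w^t* *m v).
Proof.
move=> UU hS SK tA tB hX hY XA YB uh dh da db ta tb ZZ ov ow ev ew.
rewrite -(polar_trace UU hS SK tA tB hX hY XA YB) ev ew.
exact: gauge_trace uh dh da db ta tb ZZ ov ow.
Qed.

End Blocks.

Section BlockUnitary.
Context {R : realType} {r : nat} {d : 'I_r.+1 -> nat}.
Local Notation n := (\sum_i d i)%N.
Local Notation C := R[i].

(** Unlike the existence of blocks, these two conditions are closed equations in
the entries of h and can be differentiated. *)
Lemma block_unitaryP (h : 'M[C]_n) :
  block_unitary h <-> h \is unitarymx /\ blockdiag h.
Proof.
split=> [[g ug hE]|[uh dh]].
  have dh : blockdiag h.
    by move=> i j ij; rewrite hE /mxdiag mxblockK (negPf ij).
  split=> //; apply/unitarymxP/mxblockP => i k.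
  have [<-|ik] := eqVneq i k; last first.
    rewrite blockdiag1 //; apply: (blockdiagM dh) ik; exact: blockdiag_adj.
  rewrite blockdiag_block // submxblock1 submxblock_adj.
  by rewrite hE submxblock_diag unitarymxPr.
exists (fun i => submxblock h i i) => [i|].
  apply/unitarymxP; rewrite -submxblock_adj -blockdiag_block //.
  by rewrite unitarymxPr // submxblock1.
apply/mxblockP => j k; have [->|jk] := eqVneq j k; first by rewrite submxblock_diag.
by rewrite dh // /mxdiag mxblockK (negPf jk).
Qed.

End BlockUnitary.

(** * Open conditions and quotients *)

Section Continuity.
Context {R : realType}.
Local Notation C := R[i].
Implicit Types V : normedModType R.

(** Near x, the perturbation is smaller than the lower bound for the spectrum of
K x. *)
Lemma open_posdef V n (K : V -> 'M[C]_n) : fring_mx (@Ck R V R 0 setT) K ->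
  (forall x, (K x)^t* = K x) -> open [set x | posdef (K x)].
Proof.
move=> cK hK; rewrite openE => x /= pK.
have [c c0 bK] := posdef_bound pK.
(* Real and imaginary parts replace the modulus, as a sum of continuous
   real functions. *)
pose e y : R := \sum_i \sum_j (`|complex.Re ((K y - K x) i j)| +
                               `|complex.Im ((K y - K x) i j)|).
have rC := Ck_ring 0 (@openT V).
have cE : fring_mx (@Ck R V R 0 setT) (fun y => K y - K x).
  by apply: (fring_mxD rC) => //; exact: (fring_mx_cst rC).
have ce : continuous e.
  have addc : continuous (fun z : R * R => z.1 + z.2) by exact: add_continuous.
  apply: (continuous_big addc) => i _; apply: (continuous_big addc) => j _ y.
  have [cr ci] := cE i j.
  by apply: cvgD; apply: cvg_norm; [exact: cr|exact: ci].
have cR : c = (complex.Re c)%:C%C by rewrite RRe_real // ger0_real // ltW.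
have e0 : e x < complex.Re c.
  rewrite /e subrr big1 => [|i _]; first by move: c0; rewrite ltcE => /andP[].
  by rewrite big1 // => j _; rewrite mxE normr0 addr0.
apply: (filterS _ (cvgr_lt _ (ce x) _ e0)) => y ey /=.
rewrite -(subrK (K x) (K y)) addrC; apply: posdef_perturb (bK 1) _.
  by rewrite addrC subrK.
apply: (@le_lt_trans _ _ (e y)%:C%C); last by rewrite cR ltcR.
rewrite /e rmorph_sum; apply: ler_sum => i _.
rewrite rmorph_sum; apply: ler_sum => j _.
move: ((K y - K x) i j) => [a b] /=; rewrite normc_def lecR /=.
rewrite -[leRHS]ger0_norm ?addr_ge0 // -sqrtr_sqr ler_wsqrtr //.
rewrite sqrrD !real_normK ?num_real // addrAC.
by rewrite lerDl mulrn_wge0 // mulr_ge0.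
Qed.

Lemma open_unit V n (A : V -> 'M[C]_n) : fring_mx (@Ck R V R 0 setT) A ->
  open [set x | A x \in unitmx].
Proof.
move=> cA; have rC := Ck_ring 0 (@openT V).
have [cr ci] := fring_det rC cA.
(* The square of the modulus of the determinant. *)
pose q y := complex.Re (\det (A y)) ^+ 2 + complex.Im (\det (A y)) ^+ 2.
have qE y : (0 < q y) = (A y \in unitmx).
  rewrite unitmxE unitfE /q; case: (\det _) => a b /=.
  by rewrite eq_complex /= lt_neqAle addr_ge0 ?sqr_ge0 // andbT eq_sym
    paddr_eq0 ?sqr_ge0 // !sqrf_eq0.
have cq : continuous q.
  move=> y; apply: cvgD; rewrite expr2; apply: cvgM;
    [exact: cr|exact: cr|exact: ci|exact: ci].
have -> : [set x | A x \in unitmx] = q @^-1` [set y | 0 < y].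
  by apply/seteqP; split=> x /=; rewrite qE.
by apply: open_comp; [move=> y _; exact: cq|exact: open_gt].
Qed.

End Continuity.

Section Quotients.
Context {R : realType}.
Implicit Types Q : quotient_manifold R.

Definition qequivalence Q := [/\ forall x : qamb Q, qrel x x,
  forall x y : qamb Q, qrel x y -> qrel y x
  & forall x y z : qamb Q, qrel x y -> qrel y z -> qrel x z].

Lemma qclass_eq Q (x y : qamb Q) : qequivalence Q -> qrel x y -> qclass x = qclass y.
Proof.
move=> [_ qsym qtrans] xy; apply/seteqP; split=> z [lz].
  by move=> xz; split=> //; apply: qtrans xz; exact: qsym.
by move=> yz; split=> //; exact: qtrans yz.
Qed.

Lemma qclass_rel Q (x y : qamb Q) : qequivalence Q -> qlevel y ->
  qclass x = qclass y -> qrel x y.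
Proof.
move=> [qrefl _ _] ly xy; have : qclass y y by split; [|exact: qrefl].
by rewrite -xy => -[].
Qed.

(** The map between quotients induced by f, computed on a chosen representative
of the class. *)
Definition qmap Q Q' (f : qamb Q -> qamb Q') (a : set (qamb Q)) : set (qamb Q') :=
  qclass (f (xget 0 a)).

Lemma qmapE Q Q' (f : qamb Q -> qamb Q') (x : qamb Q) : qequivalence Q ->
  qlevel x -> (forall y, qrel x y -> qclass (f x) = qclass (f y)) ->
  qmap f (qclass x) = qclass (f x).
Proof.
move=> [qrefl _ _] lx fx; rewrite /qmap; apply/esym/fx.
by case: xgetP => [y _ []//|/(_ x)] []; split.
Qed.

(** A tangent vector is the velocity of a curve in the level set, and the chain
rule turns an identity valid only on the level set into one between directional
derivatives. *)
Lemma tangent_derivmx_eq Q (x v : qamb Q) m n (phi psi : qamb Q -> 'M[R[i]]_(m, n)) :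
  qtangent x v -> diffmx phi x -> diffmx psi x ->
  (\forall y \near x, qlevel y -> phi y = psi y) ->
  derivmx phi x v = derivmx psi x v.
Proof.
move=> [c [sc lc c0 dc]] dphi dpsi pA; apply/matrixP => i j; rewrite !mxE.
have dc0 : differentiable c 0 by have [/(_ 0 Logic.I)] := sc 1.
have cA : \forall t \near 0, phi (c t) = psi (c t).
  have cc : c @ 0 --> x by rewrite -c0; exact: differentiable_continuous.
  have cA : nbhs 0 (c @^-1` [set y | qlevel y -> phi y = psi y]) := cc _ pA.
  by apply: filterS cA => t /(_ (lc t)).
have [_ Dc] := dc.
have chain (g : qamb Q -> R) : differentiable g x -> 'D_v g x = 'D_1 (g \o c) 0.
  move=> dg; rewrite -Dc; have dg' : differentiable g (c 0) by rewrite c0.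
  rewrite [RHS]deriveE; last exact: (differentiable_comp dc0 dg').
  by rewrite diff_comp //= c0 -!deriveE.
have [[dr di] [dr' di']] := (dphi i j, dpsi i j).
rewrite /derivC !chain //; congr (_ +i* _)%C; apply: near_eq_derive.
  by apply: filterS cA => t /= ->.
by apply: filterS cA => t /= ->.
Qed.

End Quotients.

(** * The polar map and its inverse *)

Section Hermpart.
Context {R : realType}.
Local Notation C := R[i].

(** The square root is needed on an open set of the ambient space, where K need
not be Hermitian.  The factor 1/2 is a scalar matrix so that the product rule
applies. *)
Definition hermpart n (K : 'M[C]_n) : 'M[C]_n := (2^-1)%:M *m (K + K^t*).

Lemma hermpart_adj n (K : 'M[C]_n) : (hermpart K)^t* = hermpart K.
Proof.
rewrite /hermpart adjM adjD trmxCK adj_scalar addrC scalar_mxC; congr (_ *m _).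
by rewrite fmorphV /= (@conj_Creal _ 2) ?realn.
Qed.

Lemma hermpart_id n (K : 'M[C]_n) : K^t* = K -> hermpart K = K.
Proof.
move=> hK; rewrite /hermpart hK mul_scalar_mx scalerDr -scalerDl -[2^-1]mul1r.
by rewrite -splitr scale1r.
Qed.

Lemma fring_hermpart (V : normedModType R) n (O : set V) P (K : V -> 'M[C]_n) :
  function_ring O P -> fring_mx P K -> fring_mx P (fun x => hermpart (K x)).
Proof.
move=> rP pK; apply: (fring_mxM rP); first exact: (fring_mx_cst rP).
by apply: (fring_mxD rP) => //; exact: (fring_mx_adj rP).
Qed.

Lemma derivmx_hermpart (V : normedModType R) n (K : V -> 'M[C]_n) x v :
  diffmx K x -> derivmx (fun y => hermpart (K y)) x v = hermpart (derivmx K x v).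
Proof.
move=> dK; have rD := diff_ring x.
have dK' : diffmx (fun y => (K y)^t*) x by exact: (fring_mx_adj rD).
rewrite derivmxM; last 2 first.
- exact: (fring_mx_cst rD).
- exact: (fring_mxD rD).
rewrite derivmx_cst mul0mx add0r /hermpart -derivmx_adj; last exact: dK.
congr (_ *m _); apply: derivmxD; [exact: dK|exact: dK'].
Qed.

Lemma derivmx_submxblock (V : normedModType R) r (d : 'I_r.+1 -> nat)
    (A : V -> 'M[C]_(\sum_i d i)) x v i j :
  derivmx (fun y => submxblock (A y) i j) x v = submxblock (derivmx A x v) i j.
Proof.
apply/matrixP => k l; rewrite !mxE; congr (derivC _ x v).
by apply/funext => y; rewrite mxE.
Qed.

Lemma diffmx_submxblock (V : normedModType R) r (d : 'I_r.+1 -> nat)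
    (A : V -> 'M[C]_(\sum_i d i)) x i j :
  diffmx A x -> diffmx (fun y => submxblock (A y) i j) x.
Proof.
move=> dA k l; apply: (fring_C_eq (diff_ring x)) (dA (tagnat.Rank i k) (tagnat.Rank j l)).
by move=> y _; rewrite mxE.
Qed.

End Hermpart.

Section Geometry.
Context {R : realType} (r : nat) (d : 'I_r.+1 -> nat) (p : 'I_r.+1 -> R).
Local Notation n := (\sum_i d i)%N.
Local Notation C := R[i].
Local Notation grp := (cmx R n n).
Local Notation flp := (cmx R n n * cmx R n n)%type.
Implicit Types (z : grp) (y : flp).

Definition gram z : 'M[C]_n := (toC z)^t* *m toC z.

Definition to_flag z : flp :=
  (ofC (toC z *m invmx (sqrtmx (gram z))), ofC (gram z)).

Definition to_gr y : grp := ofC (toC y.1 *m sqrtmx (hermpart (toC y.2))).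

Definition posdef_set : set flp := [set y | posdef (hermpart (toC y.2))].

Lemma gr_levelP z : gr_level p z <->
  forall i, submxblock (gram z) i i = ((p i)%:C)%C%:M.
Proof.
have E i : submxblock (gram z) i i = (submxrow (toC z) i)^t* *m submxrow (toC z) i.
  by apply/matrixP => k l; rewrite !mxE; apply: eq_bigr => m _; rewrite !mxE.
by split=> H i; [rewrite E|rewrite -E]; exact: H.
Qed.

Lemma gram_adj z : (gram z)^t* = gram z.
Proof. by rewrite adjM trmxCK. Qed.

Lemma gram_posdef z : toC z \in unitmx -> posdef (gram z).
Proof. exact: posdef_gram. Qed.

Lemma toC_flag1 z : toC (to_flag z).1 = toC z *m invmx (sqrtmx (gram z)).
Proof. exact: ofCK. Qed.

Lemma toC_flag2 z : toC (to_flag z).2 = gram z.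
Proof. exact: ofCK. Qed.

Lemma toC_gr y : toC (to_gr y) = toC y.1 *m sqrtmx (hermpart (toC y.2)).
Proof. exact: ofCK. Qed.

Lemma to_flag_level z : gr_level p z -> toC z \in unitmx ->
  flag_level p (to_flag z) /\ posdef_set (to_flag z).
Proof.
move=> /gr_levelP lz uz; have pK := gram_posdef uz.
have [pS SS] := sqrtmxP pK; have uS := posdef_unit pS.
rewrite /posdef_set /= /flag_level /= toC_flag1 toC_flag2 gram_adj.
rewrite hermpart_id; last exact: gram_adj.
split; last exact: pK.
split; [|exact: erefl|exact: lz].
apply/unitarymxP/mulmx1C; move: pS SS uS.
set S := sqrtmx _ => -[hS _] SS uS.
have -> : (toC z *m invmx S)^t* *m (toC z *m invmx S) =
    (invmx S)^t* *m gram z *m invmx S by rewrite adjM /gram !mulmxA.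
rewrite -SS mulmxA mulmxK // -{2}hS -adjM mulmxV //.
by rewrite adj1.
Qed.

Lemma to_gr_level y : flag_level p y -> posdef_set y ->
  [/\ gr_level p (to_gr y), toC (to_gr y) \in unitmx & gram (to_gr y) = toC y.2].
Proof.
move=> [uU hK dK]; rewrite /posdef_set /= hermpart_id // => pK.
have [pS SS] := sqrtmxP pK.
have G : gram (to_gr y) = toC y.2.
  rewrite /gram toC_gr hermpart_id // adjM (proj1 pS) mulmxA -(mulmxA _ (_^t*)).
  by rewrite unitarymxPl // mulmx1.
split=> //; first by apply/gr_levelP; rewrite G.
rewrite toC_gr hermpart_id // unitmx_mul unitarymx_unit //.
exact: posdef_unit.
Qed.

Lemma to_flagK z : toC z \in unitmx -> to_gr (to_flag z) = z.
Proof.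
move=> uz; have [pS SS] := sqrtmxP (gram_posdef uz).
rewrite /to_gr toC_flag1 toC_flag2 hermpart_id; last exact: gram_adj.
by rewrite mulmxKV ?toCK // posdef_unit.
Qed.

Lemma to_grK y : flag_level p y -> posdef_set y -> to_flag (to_gr y) = y.
Proof.
move=> ly py; have [_ _ G] := to_gr_level ly py.
have [uU hK dK] := ly; move: py; rewrite /posdef_set /= hermpart_id // => pK.
have [pS SS] := sqrtmxP pK.
rewrite /to_flag G toC_gr hermpart_id // mulmxK ?posdef_unit // !toCK.
by case: (y).
Qed.

Lemma block_unitary1 : block_unitary (d := d) (1%:M : 'M[C]_n).
Proof.
apply/block_unitaryP; split; last exact: blockdiag1.
by apply/unitarymxP; rewrite mul1mx adj1.
Qed.

Lemma block_unitaryM (h h' : 'M[C]_n) : block_unitary h -> block_unitary h' ->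
  block_unitary (h *m h').
Proof.
move=> /block_unitaryP[uh dh] /block_unitaryP[uh' dh']; apply/block_unitaryP.
split; [exact: mul_unitarymx uh uh'|exact: blockdiagM dh dh'].
Qed.

Lemma block_unitary_adj (h : 'M[C]_n) : block_unitary h -> block_unitary (h^t*).
Proof.
move=> /block_unitaryP[uh dh]; apply/block_unitaryP.
by split; [rewrite trmxC_unitary|exact: blockdiag_adj].
Qed.

Lemma gr_equivalence : qequivalence (GrProd d p).
Proof.
split=> [z|z z' [h bh zh]|z z' z'' [h bh zh] [h' bh' zh']].
- by exists 1%:M; [exact: block_unitary1|rewrite mulmx1].
- exists (h^t*); first exact: block_unitary_adj.
  have [uh _] := (iffLR (block_unitaryP h)) bh.
  by rewrite zh -mulmxA unitarymxPr // mulmx1.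
- exists (h *m h'); first exact: block_unitaryM.
  by rewrite zh' zh mulmxA.
Qed.

Lemma flag_equivalence : qequivalence (TFlag d p).
Proof.
split=> [y|y y' [h bh [yh1 yh2]]|y y' y'' [h bh [yh1 yh2]] [h' bh' [yh1' yh2']]].
- exists 1%:M; first exact: block_unitary1.
  by rewrite adj1 mul1mx !mulmx1.
- exists (h^t*); first exact: block_unitary_adj.
  have [uh _] := (iffLR (block_unitaryP h)) bh.
  rewrite yh1 yh2 trmxCK -!mulmxA unitarymxPr // !mulmx1; split=> //.
  by rewrite !mulmxA unitarymxPr // mul1mx.
- exists (h *m h'); first exact: block_unitaryM.
  rewrite yh1' yh1 yh2' yh2 adjM !mulmxA; split; exact: erefl.
Qed.

Lemma invmx_uniq (A B : 'M[C]_n) : A *m B = 1%:M -> invmx A = B.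
Proof.
move=> AB; have [uA _] := mulmx1_unit AB.
by rewrite -[RHS](mulKmx uA) AB mulmx1.
Qed.

(** If Z is replaced by Z h, then S becomes h^H S h and Z S^-1 becomes
Z h (h^H S^-1 h) = Z S^-1 h. *)
Lemma to_flag_equiv z z' : toC z \in unitmx -> gr_rel z z' ->
  flag_rel (to_flag z) (to_flag z').
Proof.
move=> uz [h bh zh]; have [uh _] := (iffLR (block_unitaryP h)) bh.
have pK := gram_posdef uz; have [pS _] := sqrtmxP pK.
have Gh : gram z' = h^t* *m gram z *m h.
  by rewrite /gram zh adjM !mulmxA; exact: erefl.
exists h; first exact: bh.
split; last first.
  apply: (etrans (toC_flag2 z') (etrans Gh _)).
  exact: (congr1 (fun K => h^t* *m K *m h) (esym (toC_flag2 z))).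
apply: (etrans (toC_flag1 z')).
apply: (etrans _ (congr1 (mulmx^~ h) (esym (toC_flag1 z)))).
rewrite Gh (sqrtmx_congr uh pK) zh; move: (sqrtmx _) pS => S pS.
have -> : invmx (h^t* *m S *m h) = h^t* *m invmx S *m h.
  apply: invmx_uniq; rewrite !mulmxA -(mulmxA _ h (h^t*)) (unitarymxPr uh) mulmx1.
  by rewrite (mulmxK (posdef_unit pS)) (unitarymxPl uh).
by rewrite !mulmxA -(mulmxA _ h (h^t*)) (unitarymxPr uh) mulmx1.
Qed.

Lemma posdef_set_equiv y y' : flag_level p y -> flag_rel y y' -> posdef_set y ->
  posdef_set y'.
Proof.
move=> [_ hK _] [h bh [_ yh]]; have [uh _] := (iffLR (block_unitaryP h)) bh.
rewrite /posdef_set /mkset (hermpart_id hK) => pK.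
have hK' : (toC y'.2)^t* = toC y'.2.
  by rewrite yh !adjM trmxCK hK mulmxA.
rewrite (hermpart_id hK') yh; exact: posdef_congr (unitarymx_unit uh) pK.
Qed.

Lemma to_gr_equiv y y' : flag_level p y -> posdef_set y -> flag_rel y y' ->
  gr_rel (to_gr y) (to_gr y').
Proof.
move=> [_ hK _]; rewrite /posdef_set /mkset (hermpart_id hK) => pK [h bh [yh1 yh2]].
have [uh _] := (iffLR (block_unitaryP h)) bh.
have hK' : (toC y'.2)^t* = toC y'.2.
  by rewrite yh2 !adjM trmxCK hK mulmxA.
exists h; first exact: bh.
apply: (etrans (toC_gr y')).
apply: (etrans _ (congr1 (mulmx^~ h) (esym (toC_gr y)))).
rewrite (hermpart_id hK) (hermpart_id hK') yh1 yh2.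
by rewrite (sqrtmx_congr uh pK) !mulmxA -(mulmxA _ h (h^t*)) (unitarymxPr uh) mulmx1.
Qed.

Lemma open_gr_unit : open [set z : grp | toC z \in unitmx].
Proof.
apply: open_unit; exact: (@toC_Ck R grp n n 0 setT idfun) (fun x => cvg_id).
Qed.

Lemma cont_fst : continuous (fst : flp -> grp). Proof. by move=> x; exact: cvg_fst. Qed.
Lemma cont_snd : continuous (snd : flp -> grp). Proof. by move=> x; exact: cvg_snd. Qed.

Lemma open_posdef_set : open posdef_set.
Proof.
apply: open_posdef => [|x]; last exact: hermpart_adj.
apply: fring_hermpart (Ck_ring 0 (@openT flp)) _.
exact: (toC_Ck _ _ cont_snd).
Qed.

Lemma smooth_to_flag : smooth_on [set z : grp | toC z \in unitmx] to_flag.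
Proof.
have oO := open_gr_unit; set O := [set z | _] in oO *.
have sZ k : fring_mx (@Ck R grp R k O) (fun z => toC z).
  exact: (@toC_Ck R grp n n k O idfun) (fun x => cvg_id).
have sG k : fring_mx (@Ck R grp R k O) gram.
  have rC := Ck_ring k oO; apply: (fring_mxM rC) => //; exact: (fring_mx_adj rC).
apply: smooth_pair => //; last exact: smooth_ofC.
apply: smooth_ofC => // k; have rC := Ck_ring k oO.
apply: (fring_mxM rC) => //; apply: (fring_invmx rC).
  by move=> z uz; have [pS _] := sqrtmxP (gram_posdef uz); exact: posdef_unit.
by apply: sqrtmx_Ck => // z; exact: gram_posdef.
Qed.

Lemma smooth_to_gr : smooth_on posdef_set to_gr.
Proof.
have oO := open_posdef_set; apply: smooth_ofC => // k; have rC := Ck_ring k oO.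
apply: (fring_mxM rC); first exact: (toC_Ck _ _ cont_fst).
apply: sqrtmx_Ck => // {rC} {}k; apply: fring_hermpart (Ck_ring k oO) _.
exact: (toC_Ck _ _ cont_snd).
Qed.

End Geometry.

(** * The two-forms *)

Section Forms.
Context {R : realType} (r : nat) (d : 'I_r.+1 -> nat) (p : 'I_r.+1 -> R).
Local Notation n := (\sum_i d i)%N.
Local Notation C := R[i].
Local Notation grp := (cmx R n n).
Local Notation flp := (cmx R n n * cmx R n n)%type.

(** The summation of the tautological form leaves out the diagonal entries, and
not the diagonal blocks. *)
Definition offdiag (K : 'M[C]_n) : 'M[C]_n :=
  \matrix_(k, j) (if j != k then K k j else 0).

Lemma offdiag_offblock (K : 'M[C]_n) : offblock K -> offdiag K = K.
Proof.
move=> oK; apply/matrixP => k j; rewrite mxE; case: ifP => // /negbFE/eqP ->.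
by rewrite mx_entry_block oK mxE.
Qed.

Lemma Pmx_diag (k : 'I_n) j : k != j -> Pmx d p k j = 0.
Proof.
move=> kj; apply: (is_diag_mxP _ k j kj).
apply/is_diag_mxblockP; split=> [i i' ii'|i]; first by rewrite (negPf ii').
by rewrite eqxx conform_mx_id; exact: scalar_mx_is_diag.
Qed.

(** On the level set the two conventions agree, the diagonal blocks being
scalar. *)
Lemma offdiag_level (K : 'M[C]_n) :
  (forall i, submxblock K i i = ((p i)%:C)%C%:M) -> offdiag K = K - Pmx d p.
Proof.
move=> dK; have oKP : offblock (K - Pmx d p).
  by move=> i; rewrite submxblockB dK submxblock_diag subrr.
rewrite -(offdiag_offblock oKP); apply/matrixP => k j.
rewrite [LHS]mxE [RHS]mxE; case: ifP => // jk; rewrite [RHS]mxE.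
rewrite [X in _ + X]mxE; have -> : Pmx d p k j = 0 by rewrite Pmx_diag // eq_sym.
by rewrite subr0.
Qed.

Lemma thetaE (y v : flp) :
  theta y v = \tr (offdiag (toC y.2) *m ((toC y.1)^t* *m toC v.1)).
Proof.
rewrite /theta (exchange_big_dep predT) //=; apply: eq_bigr => k _ /=.
rewrite mxE [RHS](bigID (fun j => j != k)) /= [X in _ + X]big1 ?addr0; last first.
  by move=> j jk; rewrite mxE (negPf jk) mul0r.
apply: eq_bigr => j jk; rewrite [X in _ = X * _]mxE jk; congr (_ * _).
by rewrite !mxE; apply: eq_bigr => l _; rewrite !mxE.
Qed.

Lemma derivmx_offdiag (V : normedModType R) (K : V -> 'M[C]_n) x v :
  derivmx (fun y => offdiag (K y)) x v = offdiag (derivmx K x v).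
Proof.
apply/matrixP => k j; rewrite !mxE; case: ifP => jk.
  by congr (derivC _ x v); apply/funext => y; rewrite mxE jk.
by rewrite -(derivC_cst 0 x v); congr (derivC _ x v); apply/funext => y; rewrite mxE jk.
Qed.

Lemma diffmx_offdiag (V : normedModType R) (K : V -> 'M[C]_n) x :
  diffmx K x -> diffmx (fun y => offdiag (K y)) x.
Proof.
move=> dK k j; case: (boolP (j != k)) => jk.
  by apply: (fring_C_eq (diff_ring x)) (dK k j) => y _; rewrite mxE jk.
apply: (fring_C_eq (diff_ring x)) (fring_C_cst (diff_ring x) 0) => y _.
by rewrite mxE (negPf jk).
Qed.

(** The product rule; the first argument of theta enters through K and U. *)
Lemma derivC_theta (y a b : flp) :
  derivC (fun x => theta x b) y a =
  \tr (offdiag (toC a.2) *m ((toC y.1)^t* *m toC b.1)) +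
  \tr (offdiag (toC y.2) *m ((toC a.1)^t* *m toC b.1)).
Proof.
have -> : (fun x => theta x b) =
    (fun x => \tr (offdiag (toC x.2) *m ((toC x.1)^t* *m toC b.1))).
  by apply/funext => x; rewrite thetaE.
have rD := diff_ring y.
have df1 : differentiable (fst : flp -> grp) y.
  exact: linear_differentiable (@cont_fst R r d).
have df2 : differentiable (snd : flp -> grp) y.
  exact: linear_differentiable (@cont_snd R r d).
have d1 := diffmx_toC df1; have d2 := diffmx_toC df2.
have e1 : derivmx (fun x : flp => toC x.1) y a = toC a.1.
  by rewrite (derivmx_toC a df1) (derive_lin _ _ (@cont_fst R r d)).
have e2 : derivmx (fun x : flp => toC x.2) y a = toC a.2.
  by rewrite (derivmx_toC a df2) (derive_lin _ _ (@cont_snd R r d)).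
have dU : diffmx (fun x : flp => (toC x.1)^t*) y by exact: (fring_mx_adj rD).
have dUb : diffmx (fun x : flp => (toC x.1)^t* *m toC b.1) y.
  apply: (fring_mxM rD) => //; exact: (fring_mx_cst rD).
have dK : diffmx (fun x : flp => offdiag (toC x.2)) y by exact: diffmx_offdiag.
rewrite derivC_tr; last exact: (fring_mxM rD).
rewrite (derivmxM _ dK dUb) mxtraceD derivmx_offdiag e2.
rewrite (derivmxM _ dU) ?derivmx_cst; last exact: (fring_mx_cst rD).
by rewrite mulmx0 addr0 (derivmx_adj _ d1) e1.
Qed.

Lemma trace_split (K P A B : 'M[C]_n) (s t : C) :
  \tr (P *m (A - B)) + (s + \tr ((K - P) *m A) - (t + \tr ((K - P) *m B))) =
  \tr (K *m (A - B)) + (s - t).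
Proof.
by rewrite !mulmxBr !mulmxBl !raddfB /=; ring.
Qed.

(** Since the diagonal blocks of K are those of P, the magnetic term completes
the off-diagonal part of K to the whole of K. *)
Lemma Omega0_tangent (y a b : flp) : flag_level p y ->
  offblock (toC a.2) -> offblock (toC b.2) ->
  Omega0_M p y a b =
  'i%C * (\tr (toC y.2 *m ((toC a.1)^t* *m toC b.1 - (toC b.1)^t* *m toC a.1)) +
   (\tr (toC a.2 *m ((toC y.1)^t* *m toC b.1)) -
    \tr (toC b.2 *m ((toC y.1)^t* *m toC a.1)))).
Proof.
move=> [_ _ dK] oa ob; rewrite /Omega0_M /wedgemx /extd !derivC_theta -mulrDr.
congr (_ * _); rewrite (offdiag_offblock oa) (offdiag_offblock ob).
rewrite (offdiag_level dK); exact: trace_split.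
Qed.

Lemma Omega_ME (z v w : grp) : Omega_M z v w =
  'i%C * (\tr ((toC v)^t* *m toC w) - \tr ((toC w)^t* *m toC v)).
Proof. by rewrite /Omega_M /wedgemx raddfB. Qed.

End Forms.

(** * Pullback of the form along an arbitrary lift *)

Section Pullback.
Context {R : realType} (r : nat) (d : 'I_r.+1 -> nat) (p : 'I_r.+1 -> R).
Local Notation n := (\sum_i d i)%N.
Local Notation C := R[i].
Local Notation grp := (cmx R n n).
Local Notation flp := (cmx R n n * cmx R n n)%type.

(** The point [to_gr (f z)] is z h(z) with h(z) block-unitary.  Differentiating
U S = Z h in both forms gives the hypotheses of [polar_gauge_trace]. *)
Lemma lift_pullback (O : set grp) (f : grp -> flp) (x v w : grp) :
  open O -> smooth_on O f -> O x -> gr_level p x -> toC x \in unitmx ->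
  (forall z, O z -> gr_level p z -> toC z \in unitmx ->
     flag_level p (f z) /\ flag_rel (to_flag z) (f z)) ->
  qtangent (Q := GrProd d p) x v -> qtangent (Q := GrProd d p) x w ->
  Omega0_M p (f x) ('D_v f x) ('D_w f x) = Omega_M x v w.
Proof.
move=> oO sf Ox lx ux lift tv tw.
(* By hypothesis f z is equivalent to the polar lift of z, which to_gr sends
   back to z. *)
have gauge z : O z -> gr_level p z -> toC z \in unitmx ->
    posdef_set (f z) /\ gr_rel z (to_gr (f z)).
  move=> Oz lz uz; have [lfz rz] := lift z Oz lz uz.
  have [lt pt] := to_flag_level lz uz.
  split; first exact: posdef_set_equiv lt rz pt.
  by have := to_gr_equiv lt pt rz; rewrite (to_flagK uz).
have df : differentiable f x by have [/(_ x Ox)] := sf 1%N.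
(* Where all the square roots and inverses below are smooth; only the level set
   points of O are known to be sent to positive definite matrices, hence the
   restriction. *)
pose N := interior (O `&` ([set z : grp | toC z \in unitmx] `&` f @^-1` (@posdef_set R r d))).
have oN : open N by exact: open_interior.
have Nx : N x.
  have [pfx _] := gauge x Ox lx ux.
  apply: filterI; first exact: open_nbhs_nbhs.
  apply: filterI; first by apply: open_nbhs_nbhs; split; [exact: open_gr_unit|].
  have pN : nbhs (f x) (@posdef_set R r d).
    by apply: open_nbhs_nbhs; split; [exact: open_posdef_set|exact: pfx].
  have cf : nbhs (f x) `<=` nbhs x \o preimage f.
    exact: differentiable_continuous df.
  exact: cf _ pN.
have nN : nbhs x N by exact: open_nbhs_nbhs.
have sN z : N z -> [/\ O z, toC z \in unitmx & posdef_set (f z)].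
  by move=> /interior_subset [Oz [uz pz]].
have rD := differentiable_ring oN Nx.
have df1 : differentiable (fst \o f) x.
  exact: differentiable_comp df (linear_differentiable _ (@cont_fst R r d)).
have df2 : differentiable (snd \o f) x.
  exact: differentiable_comp df (linear_differentiable _ (@cont_snd R r d)).
have d1 : diffmx (fun z => toC (f z).1) x.
  exact: (diffmx_toC df1).
have d2 : diffmx (fun z => toC (f z).2) x.
  exact: (diffmx_toC df2).
pose H z := hermpart (toC (f z).2).
have dH : diffmx H x by exact: (fring_hermpart rD d2).
have pH z : N z -> posdef (H z) by move=> /sN [].
have dS : diffmx (fun z => sqrtmx (H z)) x by exact: sqrtmx_diff oN Nx pH dH.
have d0 : diffmx (fun z : grp => toC z) x.
  exact: (diffmx_toC (f := id)).
pose G z := toC (f z).1 *m sqrtmx (H z).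
have dG : diffmx G x by exact: (fring_mxM rD d1 dS).
(* Defined by a formula on all of N, but block-unitary on the level set only. *)
pose h z := invmx (toC z) *m G z.
have dh : diffmx h x.
  by apply: (fring_mxM rD) dG; apply: (fring_invmx rD) d0 => z /sN [].
have hP z : N z -> gr_level p z -> block_unitary (h z).
  move=> /sN [Oz uz _] lz; have [_ [h0 bh]] := gauge z Oz lz uz.
  by rewrite toC_gr /h /G /H => ->; rewrite mulKmx.
have bhx := hP x Nx lx.
(* The linearized constraints along a tangent vector u and, last, the
   derivative of the identity U S = Z h. *)
have facts u : qtangent (Q := GrProd d p) x u ->
    let a := 'D_u f x in let U := toC (f x).1 in let S := sqrtmx (H x) in
    let X := derivmx (fun z => sqrtmx (H z)) x u in let e := derivmx h x u in
    [/\ (toC a.1)^t* *m U + U^t* *m toC a.1 = 0, offblock (toC a.2),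
        X^t* = X /\ S *m X + X *m S = toC a.2,
        blockdiag e /\ e^t* *m h x + (h x)^t* *m e = 0
      & offblock ((toC u)^t* *m toC x + (toC x)^t* *m toC u) /\
        toC a.1 *m S + U *m X = toC u *m h x + toC x *m e].
  move=> tu a U S X e.
  have D1 : derivmx (fun z => toC (f z).1) x u = toC a.1.
    rewrite (derivmx_toC u df1).
    by rewrite (@derive_diff_comp R _ _ _ f fst x u df (@cont_fst R r d)).
  have D2 : derivmx (fun z => toC (f z).2) x u = toC a.2.
    rewrite (derivmx_toC u df2).
    by rewrite (@derive_diff_comp R _ _ _ f snd x u df (@cont_snd R r d)).
  have D0 : derivmx (fun z : grp => toC z) x u = toC u.
    by rewrite (derivmx_toC u (f := id)) ?derive_id.
  have lf z : N z -> gr_level p z -> flag_level p (f z).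
    by move=> /sN [Oz uz _] lz; have [] := lift z Oz lz uz.
  have onN (Q : grp -> Prop) : (forall z, N z -> gr_level p z -> Q z) ->
      \forall z \near x, gr_level p z -> Q z.
    by move=> NQ; apply: filterS nN => z Nz lz; exact: NQ.
  have T m k (phi psi : grp -> 'M[C]_(m, k)) : diffmx phi x -> diffmx psi x ->
      (forall z, N z -> gr_level p z -> phi z = psi z) ->
      derivmx phi x u = derivmx psi x u.
    move=> dphi dpsi pp.
    exact: (@tangent_derivmx_eq _ (GrProd d p) _ _ _ _ phi psi tu dphi dpsi (onN _ pp)).
  have cst m k (A : 'M[C]_(m, k)) : diffmx (fun _ : grp => A) x.
    exact: (fring_mx_cst rD).
  have T0 m k (phi : grp -> 'M[C]_(m, k)) A : diffmx phi x ->
      (forall z, N z -> gr_level p z -> phi z = A) -> derivmx phi x u = 0.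
    by move=> dphi pA; rewrite (T _ _ phi (fun=> A) dphi (cst _ _ A) pA) derivmx_cst.
  have herma : (toC a.2)^t* = toC a.2.
    rewrite -D2 -(derivmx_adj _ d2).
    by apply: (T _ _ _ _ (fring_mx_adj rD d2) d2) => z Nz /(lf z Nz) [_ + _].
  have dU := fring_mx_adj rD d1; have dh' := fring_mx_adj rD dh.
  split.
  - rewrite -D1 -(derivmx_adj _ d1) -(derivmxM _ dU d1).
    apply: (T0 _ _ _ 1%:M (fring_mxM rD dU d1)) => z Nz /(lf z Nz) [uz _ _].
    exact: unitarymxPl uz.
  - move=> i; rewrite -D2 -derivmx_submxblock.
    apply: (T0 _ _ _ ((p i)%:C)%C%:M (diffmx_submxblock (i:=i) (j:=i) d2)) => z Nz.
    by move=> /(lf z Nz) [_ _ /(_ i)].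
  - split.
      rewrite -(derivmx_adj _ dS); apply: derivmx_near; apply: filterS nN => z Nz.
      by have [[]] := sqrtmxP (pH z Nz).
    rewrite (derivmx_sqrtmx _ oN Nx pH dH) (derivmx_hermpart _ d2) D2.
    exact: hermpart_id herma.
  - split.
      move=> i j ij; rewrite -derivmx_submxblock.
      apply: (T0 _ _ _ 0 (diffmx_submxblock (i:=i) (j:=j) dh)) => z Nz lz.
      by have [_ bd] := (iffLR (block_unitaryP _)) (hP z Nz lz); exact: bd.
    rewrite -(derivmx_adj _ dh) -(derivmxM _ dh' dh).
    apply: (T0 _ _ _ 1%:M (fring_mxM rD dh' dh)) => z Nz lz.
    have [uz _] := (iffLR (block_unitaryP _)) (hP z Nz lz).
    exact: unitarymxPl uz.
  - have dZ' := fring_mx_adj rD d0; split.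
      move=> i; rewrite -D0 -(derivmx_adj _ d0) -(derivmxM _ dZ' d0).
      rewrite -derivmx_submxblock.
      apply: (T0 _ _ _ ((p i)%:C)%C%:M (diffmx_submxblock (i:=i) (j:=i) (fring_mxM rD dZ' d0))).
      by move=> z _ /gr_levelP /(_ i).
    rewrite -D1 -D0 -(derivmxM _ d1 dS) -(derivmxM _ d0 dh).
    apply: derivmx_near; apply: filterS nN => z /sN [_ uz _].
    by rewrite /h mulKVmx.
have [ta1 oa [hX SX] [de te] [ov Gv]] := facts v tv.
have [tb1 ob [hY SY] [df' te'] [ow Gw]] := facts w tw.
have [lfx _] := lift x Ox lx ux; have [uU hK dK] := lfx.
have HK : H x = toC (f x).2 by exact: hermpart_id hK.
have [[hS _] SS] := sqrtmxP (pH x Nx).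
have [uh bh] := (iffLR (block_unitaryP _)) bhx.
rewrite (Omega0_tangent lfx oa ob) Omega_ME; congr (_ * _).
exact: (polar_gauge_trace (unitarymxPl uU) hS (etrans SS HK) ta1 tb1 hX hY SX SY
  uh bh de df' te te' ((iffLR (gr_levelP p x)) lx) ov ow Gv Gw).
Qed.

End Pullback.

Theorem proposition7 (R : realType) (r : nat) (d : 'I_r.+1 -> nat)
    (p : 'I_r.+1 -> R) (hd : forall i, (0 < d i)%N) (hp : forall i, 0 < p i) :
  exists B : set (set (qamb (TFlag d p))),
    qopen (Q := TFlag d p) B /\
    symplectomorphic (Q := GrProd d p) (Q' := TFlag d p) (gr_det_neq0 d p) B.
Proof.
pose Q := GrProd d p; pose Q' := TFlag d p.
have eqv := gr_equivalence d p; have eqv' := flag_equivalence d p.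
pose B : set (set (qamb Q')) := @qclass R Q' @` (flag_level p `&` @posdef_set R r d).
have inA (z : qamb Q) : gr_level p z -> gr_det_neq0 d p (qclass z) -> toC z \in unitmx.
  move=> lz [z' [lz' /= uz'] zz'].
  have [h bh ->] := qclass_rel eqv lz zz'.
  have [uh _] := (iffLR (block_unitaryP h)) bh.
  by rewrite unitmx_mul unitmxE unitfE uz' unitarymx_unit.
have Ain (z : qamb Q) : gr_level p z -> toC z \in unitmx -> gr_det_neq0 d p (qclass z).
  by move=> lz uz; exists z => //; split=> //=; rewrite -unitfE -unitmxE.
have inB (y : qamb Q') : flag_level p y -> B (qclass y) -> posdef_set y.
  move=> ly [y' [ly' py'] yy'].
  exact: posdef_set_equiv ly' (qclass_rel eqv' ly yy') py'.
have Bin (y : qamb Q') : flag_level p y -> posdef_set y -> B (qclass y).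
  by move=> ly py; exists y.
pose F := @qmap R Q Q' (@to_flag R r d); pose G := @qmap R Q' Q (@to_gr R r d).
have FE (z : qamb Q) : gr_level p z -> toC z \in unitmx ->
    F (qclass z) = @qclass R Q' (to_flag z).
  move=> lz uz; apply: (@qmapE R Q Q' (@to_flag R r d) z eqv lz) => z' zz'.
  exact: (@qclass_eq R Q' _ _ eqv' (to_flag_equiv uz zz')).
have GE (y : qamb Q') : flag_level p y -> posdef_set y ->
    G (qclass y) = @qclass R Q (to_gr y).
  move=> ly py; apply: (@qmapE R Q' Q (@to_gr R r d) y eqv' ly) => y' yy'.
  exact: (@qclass_eq R Q _ _ eqv (to_gr_equiv ly py yy')).
exists B; split.
  split=> [_ [y [ly _] <-]|]; first by exists y.
  exists (@posdef_set R r d); first exact: open_posdef_set.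
  by move=> y ly; split=> [/(inB y ly)|/(Bin y ly)].
exists F, G; split.
- move=> _ [z [lz uz] <-].
  have {}uz : toC z \in unitmx by rewrite unitmxE unitfE.
  have [lf pf] := to_flag_level lz uz.
  rewrite (FE z lz uz); split; first exact: Bin.
  by rewrite (GE _ lf pf) (to_flagK uz).
- move=> _ [y [ly py] <-]; have [lg ug _] := to_gr_level ly py.
  rewrite (GE y ly py); split; first exact: Ain.
  by rewrite (FE _ lg ug) (to_grK ly py).
- move=> z lz /(inA z lz) uz.
  exists [set z | toC z \in unitmx], (@to_flag R r d); split; first exact: uz.
  split; [exact: open_gr_unit|exact: smooth_to_flag|] => z' uz' lz' _.
  by have [lf _] := to_flag_level lz' uz'; rewrite (FE z' lz' uz').
- move=> y ly /(inB y ly) py.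
  exists (@posdef_set R r d), (@to_gr R r d); split; first exact: py.
  split; [exact: open_posdef_set|exact: smooth_to_gr|] => y' py' ly' _.
  by have [lg _ _] := to_gr_level ly' py'; rewrite (GE y' ly' py').
- move=> O f [oO sf lift] x v w Ox lx /(inA x lx) ux tv tw.
  apply: (lift_pullback oO sf Ox lx ux _ tv tw) => z Oz lz uz.
  have [lf Ff] := lift z Oz lz (Ain z lz uz); split; first exact: lf.
  exact: (@qclass_rel R Q' _ _ eqv' lf (etrans (esym (FE z lz uz)) Ff)).
Qed.
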